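(* Let $G$ be a discrete free Fuchsian group of rank two with invariant disc $\Delta$, without parabolic elements, whose generators have intersecting axes; let $A,B$ be stopping generators and let $H=\mathbb H^3/G$. Let $s>0$ and let $q(s)=V_p(s)$, $p(s)=V_p(-s)$, $q_A(s)=V_{p_A}(s)$, $p_A(s)=V_{p_A}(-s)$, $q_B(s)=V_{p_B}(s)$, $p_B(s)=V_{p_B}(-s)$ be the intersection points of the lines $V_p,V_{p_A},V_{p_B}$ with the equidistant surfaces $\Pi(\pm s)$. Then the projections to $H$ of the points $p(s),q(s),p_A(s),q_A(s),p_B(s),q_B(s)$ lie on the surface $\mathcal S(s)\subset H$ and comprise the set of fixed points of the hyperelliptic isometry $j$ restricted to $\mathcal S(s)$.
   Context: $\mathbb H^3$ is upper half-space with boundary $\hat{\mathbb C}$; $\Delta=\{|z|<1\}$; $\mathbb P\subset\mathbb H^3$ is the hyperbolic plane with boundary $\partial\Delta$. $G$ acts on $\mathbb H^3$ preserving $\mathbb P$ and each of its two sides (the exterior side faces $\{|z|>1\}$, the interior side faces $\Delta$). $[X,Y]=XYX^{-1}Y^{-1}$. $Ax_W$ denotes the axis of $W\in G$; it lies in $\mathbb P$. For $x\in\mathbb P$, $V_x(t)$, $t\in\mathbb R$, is the arclength-parameterized line orthogonal to $\mathbb P$ with $V_x(0)=x$, directed so that $t>0$ is on the exterior side, and $H_x$ is the half-turn about this line. Stopping generators (intersecting axes): for generators $A,B$ with intersecting axes let $p=Ax_A\cap Ax_B$ and let $p_A,p_B\in\mathbb P$ be the points with $A=H_pH_{p_A}$,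 $B=H_pH_{p_B}$. The pair is stopping if the distances between $p,p_A,p_B$ are minimal among all Nielsen equivalent pairs of generators, i.e. $d(p,p_A)\le d(p,p_B)\le d(p_A,p_B)$ and the traces of $A,B$ (in absolute value) are minimal among all pairs of generators of $G$. The involution $j$: $G$ is a normal subgroup of index two in $\langle H_p,H_{p_A},H_{p_B}\rangle$, and $H_p,H_{p_A},H_{p_B}$ differ by elements of $G$; $j:H\to H$ is the order two isometry they all induce. The surface $\mathcal S(s)$: $\mathcal C\subset\mathbb P$ is the hyperbolic convex hull in $\mathbb H^3$ of the limit set of $G$. Put $\Pi(\pm s)=\{V_x(\pm s):x\in\mathbb P\}$, $N_{ext}(s)=\{V_x(s):x\in\mathcal C\}/G$, $N_{int}(s)=\{V_x(-s):x\in\mathcal C\}/G$. Let $Eq_{[B,A]}(s)$ be the set of points at distance $s$ from $Ax_{[B,A]}$ (a boundary line of $\mathcal C$ in $\mathbb P$; all boundary lines are its $G$-translates). The curves $Eq_{[B,A]}(s)\cap\Pi(\pm s)$ divide it into two strips, exactly one of which is disjoint from $\mathcal C$; call it $Rec_{[B,A]}(s)$, and let $F_{[B,A]}(s)$ be its image in $H$. Then $\mathcal S(s)=N_{ext}(s)\cup N_{int}(s)\cup F_{[B,A]}(s)$. *)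

(* Defs.v *)
From mathcomp Require Import all_boot all_order all_algebra.
From mathcomp Require Import complex.
From mathcomp Require Import all_classical all_reals all_analysis.
From mathcomp Require Import ring lra.

Set Implicit Arguments.
Unset Strict Implicit.
Unset Printing Implicit Defensive.

Import Order.TTheory GRing.Theory Num.Theory.
Import numFieldNormedType.Exports.

Local Open Scope classical_set_scope.
Local Open Scope ring_scope.
Local Open Scope complex_scope.

(* Points of R^3 are triples (Re z, Im z, t), with the product topology; upper
   half-space is the subset t > 0 and its ideal boundary is option R[i], where
   None stands for the point at infinity. *)
Notation point3 R := (R * R * R)%type.

Section HyperbolicSpace.
Variable R : realType.
Implicit Types (x y : point3 R) (c v : R -> point3 R) (s t : R) (z : R[i]).

Definition sqmod z : R := complex.Re z ^+ 2 + complex.Im z ^+ 2.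
Definition coz x : R[i] := x.1.1 +i* x.1.2.
Definition height x : R := x.2.
Definition mkpoint z t : point3 R := (complex.Re z, complex.Im z, t).

Definition H3 : set (point3 R) := [set x | 0 < height x].

Definition edist2 x y : R := sqmod (coz x - coz y) + (height x - height y) ^+ 2.
Definition enorm2 x : R := sqmod (coz x) + height x ^+ 2.

Definition coshR t : R := (expR t + expR (- t)) / 2.
Definition sinhR t : R := (expR t - expR (- t)) / 2.
Definition arcoshR t : R := ln (t + Num.sqrt (t ^+ 2 - 1)).

Definition hdist x y : R :=
  arcoshR (1 + edist2 x y / (2 * height x * height y)).

Definition set_dist x (L : set (point3 R)) : R := inf [set hdist x a | a in L].

Definition geodesic c : Prop :=
  (forall t, H3 (c t)) /\ (forall s t, hdist (c s) (c t) = `|s - t|).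

Definition near_ideal (e : R) (xi : option R[i]) x : Prop :=
  match xi with
  | Some z => edist2 x (mkpoint z 0) < e ^+ 2
  | None => e ^- 2 < enorm2 x
  end.

Definition ends_at c (xi : option R[i]) : Prop :=
  forall e : R, 0 < e -> exists T : R,
    forall t, T <= t -> near_ideal e xi (c t).

Definition hconvex (K : set (point3 R)) : Prop :=
  forall x y w, K x -> K y -> H3 w ->
    hdist x w + hdist w y = hdist x y -> K w.

Definition hconvex_hull (L : set (option R[i])) : set (point3 R) :=
  [set x | forall K : set (point3 R), K `<=` H3 -> hconvex K ->
     (forall c (xi eta : option R[i]), geodesic c -> L xi -> L eta ->
        ends_at c xi -> ends_at (fun t => c (- t)) eta -> range c `<=` K) ->
     K x].

Definition disc : set R[i] := [set z | `|z| < 1].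

Definition plane : set (point3 R) := [set x | H3 x /\ enorm2 x = 1].

(* In the hyperboloid model, where x has coordinates
     (z / t, (|x|^2 - 1) / (2 t), (|x|^2 + 1) / (2 t)),
   the plane is the zero set of the second coordinate, with unit normal
   n = (0, 1, 0), and the normal line at x is s |-> cosh s x + sinh s n.
   The lemmas ending this section show that this is the arclength
   parametrization of the line orthogonal to the plane at x, directed to the
   exterior of the unit sphere for s > 0. *)
Definition V x s : point3 R :=
  let k := (coshR s - height x * sinhR s)^-1 in
  (k * coshR s * x.1.1, k * coshR s * x.1.2, k * height x).

Definition equidistant_surface s : set (point3 R) := [set V x s | x in plane].

Lemma coshR_sinhR t : coshR t ^+ 2 - sinhR t ^+ 2 = 1.
Proof.
rewrite /coshR /sinhR expRN; have := expR_eq0 t; move: (expR t) => u u0.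
by field; rewrite u0.
Qed.

Lemma plane_height x : plane x -> 0 < height x <= 1.
Proof.
move=> [hx]; rewrite /enorm2 /sqmod /= => e; rewrite hx /= -subr_ge0.
have := sqr_ge0 (complex.Re (coz x)); have := sqr_ge0 (complex.Im (coz x)).
by move: (height x) (complex.Re _) (complex.Im _) hx e => h a b; nra.
Qed.

Lemma V_den_gt0 x s : plane x -> 0 < coshR s - height x * sinhR s.
Proof.
move=> /plane_height/andP[h0 h1]; rewrite /coshR /sinhR.
have := expR_gt0 s; have := expR_gt0 (- s).
by move: (expR s) (expR (- s)) (height x) h0 h1 => u w h; nra.
Qed.

Lemma V_H3 x s : plane x -> H3 (V x s).
Proof.
move=> Px; rewrite /H3 /= mulr_gt0 ?invr_gt0 ?V_den_gt0 //.
by have /andP[] := plane_height Px.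
Qed.

Lemma arcosh_cosh t : arcoshR (coshR t) = `|t|.
Proof.
wlog t0 : t / 0 <= t => [hw|].
  have [/hw//|/ltW t0] := leP 0 t.
  by rewrite -normrN -hw ?oppr_ge0 // /coshR opprK addrC.
have -> : arcoshR (coshR t) = ln (coshR t + sinhR t).
  rewrite /arcoshR; have -> : coshR t ^+ 2 - 1 = sinhR t ^+ 2.
    by rewrite -(coshR_sinhR t) opprB addrC subrK.
  rewrite sqrtr_sqr ger0_norm // /sinhR divr_ge0 // subr_ge0 ler_expR.
  by rewrite ge0_cp.
have -> : coshR t + sinhR t = expR t by rewrite /coshR /sinhR; field.
by rewrite expRK ger0_norm.
Qed.

Lemma V_geodesic x : plane x -> geodesic (V x).
Proof.
move=> Px; split=> [t|s t]; first exact: V_H3.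
rewrite -arcosh_cosh /hdist; congr arcoshR.
have ds := V_den_gt0 s Px; have dt := V_den_gt0 t Px.
have /andP[h0 _] := plane_height Px.
case: Px => _; rewrite /enorm2 /edist2 /sqmod /V /=.
case: x ds dt h0 => [[a b] h]; rewrite /height /= => ds dt h0 abh.
have -> : coshR (s - t) = coshR s * coshR t - sinhR s * sinhR t.
  by rewrite /coshR /sinhR opprB !expRD; field.
have key : (1 - h ^+ 2) * (coshR s * sinhR t - coshR t * sinhR s) ^+ 2
    + ((coshR t - h * sinhR t) - (coshR s - h * sinhR s)) ^+ 2
  = 2 * (coshR s - h * sinhR s) * (coshR t - h * sinhR t)
    * (coshR s * coshR t - sinhR s * sinhR t - 1).
  rewrite /coshR /sinhR !expRN; have := expR_eq0 s; have := expR_eq0 t.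
  by move: (expR s) (expR t) => u v u0 v0; field; rewrite u0 v0.
move: (coshR s) (sinhR s) (coshR t) (sinhR t) ds dt key => p q u w ds dt key.
have [P0 U0 h00] : [/\ p - h * q != 0, u - h * w != 0 & h != 0].
  by split; rewrite gt_eqF.
have eab : 1 - h ^+ 2 = a ^+ 2 + b ^+ 2 by rewrite -abh; ring.
apply: (addrI (-1)); rewrite addrA addNr add0r.
apply: (mulIf (mulf_neq0 P0 U0)); apply: (mulIf (_ : 2 != 0 :> R)) => //.
rewrite [RHS](_ : _ = (1 - h ^+ 2) * (p * w - u * q) ^+ 2
    + ((u - h * w) - (p - h * q)) ^+ 2); last by rewrite key; ring.
rewrite eab; field.
by rewrite h00 P0 U0.
Qed.

Lemma V0 x : V x 0 = x.
Proof.
by case: x => [[a b] h]; rewrite /V /coshR /sinhR oppr0 expR0 subrr mul0r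
  mulr0 subr0 divff ?pnatr_eq0 // invr1 !mul1r.
Qed.

Lemma is_derive_coshR t : is_derive t 1 coshR (sinhR t).
Proof.
rewrite /coshR /sinhR; apply: is_derive_eq.
by rewrite /GRing.scale /=; field.
Qed.

Lemma is_derive_sinhR t : is_derive t 1 sinhR (coshR t).
Proof.
rewrite /coshR /sinhR; apply: is_derive_eq.
by rewrite /GRing.scale /=; field.
Qed.

(* As the metric is conformal and x is normal to the unit sphere at x, V x is
   orthogonal to the plane and starts towards the exterior. *)
Lemma V_orthogonal x : plane x ->
  [/\ is_derive (0 : R) 1 (fun s => (V x s).1.1) (height x * x.1.1),
      is_derive (0 : R) 1 (fun s => (V x s).1.2) (height x * x.1.2) &
      is_derive (0 : R) 1 (fun s => (V x s).2) (height x * x.2)].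
Proof.
move=> Px.
have c0 : coshR 0 = 1 by rewrite /coshR oppr0 expR0; field.
have s0 : sinhR 0 = 0 by rewrite /sinhR oppr0 expR0; field.
have dc := is_derive_coshR 0; have dsn := is_derive_sinhR 0.
have dk : is_derive (0 : R) 1 (fun s => (coshR s - height x * sinhR s)^-1)
    (height x).
  have d : is_derive (0 : R) 1 (fun s => coshR s - height x * sinhR s)
     (- height x).
    apply: is_derive_eq.
    by rewrite /GRing.scale /= c0 s0; ring.
  apply: is_derive_eq.
    apply: is_deriveV.
    by rewrite s0 c0 mulr0 subr0 oner_eq0.
  rewrite /GRing.scale /= c0 s0 mulr0 subr0 expr1n invr1; ring.
split; apply: is_derive_eq;
  by rewrite /GRing.scale /= c0 s0 ?(mulr0, subr0, invr1); ring.
Qed.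

End HyperbolicSpace.

Section Groups.
Variable R : realType.
Local Notation C := R[i].
Local Notation mx := 'M[C]_2.
Implicit Types (M N W X Y A B h g : mx) (G : set mx) (x y p : point3 R).

(* Elements of PSL(2,C) are represented by matrices of SL(2,C) up to sign, and
   a subgroup of PSL(2,C) by its full preimage in SL(2,C). *)
Definition eq_pm M N : Prop := M = N \/ M = - N.

Definition psl_subgroup G : Prop :=
  [/\ forall M, G M -> \det M = 1,
      G 1, forall M, G M -> G (- M) &
      forall M N, G M -> G N -> G (M * N^-1)].

Definition mob_den M (z : C) : C := M 1 0 * z + M 1 1.
Definition mob M (z : C) : C := (M 0 0 * z + M 0 1) / mob_den M z.

(* The Poincare extension of mob M to H3, for det M = 1:
     (z, t) |-> ((a z + b) (c z + d)^* + a c^* t^2, t)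
                  / (|c z + d|^2 + |c|^2 t^2) *)
Definition act M x : point3 R :=
  let z := coz x in let t := height x in
  let d := sqmod (mob_den M z) + sqmod (M 1 0) * t ^+ 2 in
  mkpoint (((M 0 0 * z + M 0 1) * (mob_den M z)^*
            + M 0 0 * (M 1 0)^* * (t ^+ 2)%:C) * (d^-1)%:C)
          (t / d).

Definition discrete_subgroup G : Prop :=
  exists2 e : C, 0 < e &
    forall g, G g -> (forall i j, `|g i j - (1 : mx) i j| < e) -> g = 1.

Definition invariant_disc G : Prop :=
  forall g z, G g -> disc z -> mob_den g z != 0 /\ disc (mob g z).

(* A letter (b, e) stands for X (b = false) or Y (b = true), inverted if
   e = true. *)
Definition letter X Y (l : bool * bool) : mx :=
  let g := if l.1 then Y else X in if l.2 then g^-1 else g.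
Definition word X Y (w : seq (bool * bool)) : mx := \prod_(l <- w) letter X Y l.
Definition reduced (w : seq (bool * bool)) : bool :=
  sorted (fun l m => ~~ ((l.1 == m.1) && (l.2 != m.2))) w.

Definition generators G X Y : Prop :=
  [/\ G X, G Y & forall M, G M -> exists w, eq_pm M (word X Y w)].

Definition free_of_rank_two G : Prop :=
  exists X Y, generators G X Y /\
    forall w, reduced w -> w <> [::] -> ~ eq_pm (word X Y w) 1.

Definition no_parabolic G : Prop :=
  forall g, G g -> eq_pm g 1 \/ (\tr g) ^+ 2 != 4.

Definition pair_commutator X Y : mx := X * Y * X^-1 * Y^-1.

Definition axis W : set (point3 R) :=
  [set x | exists c : R -> point3 R, geodesic c /\
     (exists2 l : R, 0 < l & forall t, act W (c t) = c (t + l)) /\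
     range c x].

Definition half_turn (L : set (point3 R)) h : Prop :=
  [/\ \det h = 1, eq_pm (h * h) 1 & [set x | H3 x /\ act h x = x] = L].

Definition limit_set G : set (option C) :=
  [set xi | exists2 x, H3 x &
     forall e : R, 0 < e -> exists2 g, G g & near_ideal e xi (act g x)].

Definition convex_core G : set (point3 R) := hconvex_hull (limit_set G).

Definition stopping G A B p pA pB : Prop :=
  [/\ generators G A B, axis A `&` axis B = [set p],
      hdist p pA <= hdist p pB <= hdist pA pB &
      forall X Y, generators G X Y -> `|\tr X| <= `|\tr Y| ->
        `|\tr A| <= `|\tr X| /\ `|\tr B| <= `|\tr Y|].

(* The quotient H = H3 / G is the set of G-orbits in H3. *)
Definition to_quotient G x : set (point3 R) := [set act g x | g in G].

(* The map of H3 / G induced by an isometry h normalizing G: the image under h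
   of the orbit of x is the orbit of h x.  Isometries differing by an element
   of G induce the same map. *)
Definition descend h (O : set (point3 R)) : set (point3 R) := act h @` O.

Definition Next G (s : R) : set (set (point3 R)) :=
  to_quotient G @` [set V x s | x in convex_core G].
Definition Nint G (s : R) : set (set (point3 R)) :=
  to_quotient G @` [set V x (- s) | x in convex_core G].

Definition Eq W (s : R) : set (point3 R) :=
  [set y | H3 y /\ set_dist y (axis W) = s].

Definition Eq_curves W (s : R) : set (point3 R) :=
  Eq W s `&` (equidistant_surface s `|` equidistant_surface (- s)).

(* Used with W = [B, A], whose axis bounds the convex core.  The strips are the
   connected components of the complement of the curves, with the curves
   added. *)
Definition Rec G W (s : R) : set (point3 R) :=
  let D := Eq W s `\` Eq_curves W s in
  Eq_curves W s `|`
  [set y | D y /\ connected_component D y `&` convex_core G = set0].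

Definition surface G W (s : R) : set (set (point3 R)) :=
  Next G s `|` Nint G s `|` (to_quotient G @` Rec G W s).

End Groups.

(* Main.v *)
Require Import Defs.
From mathcomp Require Import all_boot all_order all_algebra.
From mathcomp Require Import fingroup perm complex.
From mathcomp Require Import all_classical all_reals all_analysis.
From mathcomp Require Import ring lra zify.

(* An orbit fixed by j is the orbit of a point y fixed by h = g hp for some g in
   G.  As h^2 lies in G and fixes y, discreteness and freeness give h^2 = 1 in
   PSL(2,C).  Conjugation by hp inverts A and B, so the reduced word of g in the
   free basis A, B is a palindrome v m v^rev with m empty or a letter, whence h
   is conjugate in G to hp, hA or hB; so, up to G, y = V q u with q one of
   p, pA, pB.

   The signed distance to the plane is invariant under G, and it is s or -s on
   the two equidistant sheets and on the two curves bounding the strips; there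
   u = s or u = -s.  It remains to exclude the interior of Rec.  The point
   x = g q below such a y lies on a line m of the convex core, the axis of a
   conjugate of A or B.  Moving x along m away from the axis of [B, A], and
   lowering y above it so as to stay at distance s from that axis, joins y
   inside its strip to the point of m at distance s, which belongs to the core. *)

Set Implicit Arguments.
Unset Strict Implicit.
Unset Printing Implicit Defensive.

Import Order.TTheory GRing.Theory Num.Theory.
Import numFieldNormedType.Exports.

Local Open Scope classical_set_scope.
Local Open Scope ring_scope.

(** * Words and free groups *)

(** Freeness is given for some pair of generators, while the palindrome argument needs the pair A, B
    itself to be a free basis; the Hopf property of free groups of rank two provides the passage.
    Discreteness serves to show that an element of G fixing a point has finite order; freeness then
    makes it trivial.

    Geodesics, distances to a line and ends become linear algebra in the hyperboloid model: a
    geodesic is e^t a + e^-t b with a and b null, and equalities of points follow from pairings. The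
    action is linearized separately, on Hermitian matrices of determinant 1. Invariance of the disc
    is turned into membership in SU(1,1), which is what makes the signed distance to the plane
    invariant.

    The shape of the convex core is never determined: the proof works with the two facts that it
    lies in the plane and that it contains the axes of the elements of G. *)

Definition flipl (l : bool * bool) : bool * bool := (l.1, ~~ l.2).
Definition winv (w : seq (bool * bool)) := rev (map flipl w).
Definition cancels (l m : bool * bool) : bool := (l.1 == m.1) && (l.2 != m.2).

Lemma cancelsE l m : cancels l m = (m == flipl l).
Proof. by case: l m => [[] []] [[] []]. Qed.

Lemma fliplK : involutive flipl.
Proof. by case=> [b e]; rewrite /flipl /= negbK. Qed.

Definition push l (w : seq (bool * bool)) :=
  if w is m :: w' then if cancels l m then w' else l :: w else [:: l].
Definition reduce w := foldr push [::] w.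

Lemma reduced_cons2 l m w :
  reduced [:: l, m & w] = ~~ cancels l m && reduced (m :: w).
Proof. by []. Qed.

Lemma reduced_reduce w : reduced (reduce w).
Proof.
elim: w => //= l w; case: (reduce w) => [//|m w'] /= red.
case: ifP => [_|/negbT nc]; first by case: w' red => //= k w'' /andP[].
by rewrite reduced_cons2 nc.
Qed.

(** This is the endomorphism of the free group sending the two letters to [u] and [v]; it rewrites
    words in A, B as words in X, Y. *)
Definition subst (u v w : seq (bool * bool)) :=
  flatten [seq (let x := if l.1 then v else u in if l.2 then winv x else x)
          | l <- w].

(** * Evaluation of words in finite groups *)

Section WordInGroup.
Variable gT : finGroupType.
Implicit Types a b : gT.

(** A pair (a, b) stands for a homomorphism from the free group of rank two to [gT], and [gword a b]
    for its values. *)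
Definition gletter a b (l : bool * bool) : gT :=
  (let g := if l.1 then b else a in if l.2 then g^-1 else g)%g.
Definition gword a b w : gT := (\prod_(l <- w) gletter a b l)%g.

Lemma gletter_flip a b l : gletter a b (flipl l) = ((gletter a b l)^-1)%g.
Proof. by case: l => [x []]; rewrite /gletter /= ?invgK. Qed.

Lemma gword_cons a b l w : gword a b (l :: w) = (gletter a b l * gword a b w)%g.
Proof. by rewrite /gword big_cons. Qed.

Lemma gword_cat a b w w' : gword a b (w ++ w') = (gword a b w * gword a b w')%g.
Proof. by rewrite /gword big_cat. Qed.

Lemma gword_inv a b w : gword a b (winv w) = ((gword a b w)^-1)%g.
Proof.
elim: w => [|l w IH]; first by rewrite /gword !big_nil invg1.
rewrite /winv /= rev_cons -cats1 gword_cat -/(winv w) IH !gword_cons invMg.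
by rewrite gletter_flip /gword big_nil mulg1.
Qed.

Lemma gword_reduce a b w : gword a b (reduce w) = gword a b w.
Proof.
elim: w => //= l w IH; rewrite gword_cons -IH.
case: (reduce w) => [|m w'] /=; first by rewrite gword_cons.
case: ifP => [|_]; last by rewrite !gword_cons.
by rewrite cancelsE => /eqP ->; rewrite gword_cons gletter_flip mulKVg.
Qed.

Lemma gword_subst a b u v w :
  gword a b (subst u v w) = gword (gword a b u) (gword a b v) w.
Proof.
elim: w => [|[x e] w IH]; first by rewrite /gword /= !big_nil.
rewrite /subst /= gword_cat -/(subst u v w) IH gword_cons; congr (_ * _)%g.
by case: x e => [] [] /=; rewrite ?gword_inv.
Qed.

End WordInGroup.

(** One pair is added at a time: composing with the transposition of f x and y corrects the value at
    x, and it moves no earlier value, since these differ from both f x and y. *)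
Lemma perm_extension (T : finType) (r : seq (T * T)) :
  uniq (map fst r) -> uniq (map snd r) ->
  exists f : {perm T}, forall q, q \in r -> f q.1 = q.2.
Proof.
elim: r => [|[x y] r IH] /=; first by exists 1%g.
move=> /andP[xr ur] /andP[yr vr]; have [f fr] := IH ur vr.
exists (f * tperm (f x) y)%g => q; rewrite inE permM => /predU1P[->|qr] /=.
  by rewrite tpermL.
rewrite fr // tpermD //.
  rewrite -fr // (inj_eq perm_inj); apply: contraNneq xr => ->.
  exact: map_f.
by apply: contraNneq yr => ->; apply: map_f.
Qed.

(* The letters of w are made to act as i |-> i + 1 along w, so that the word
   sends 0 to the length of w. *)
Lemma reduced_gword_neq1 w : reduced w -> w <> [::] ->
  exists a b : {perm 'I_(size w).+1}, gword a b w <> 1%g.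
Proof.
move=> red w0; set n := size w.
have consec i : (i.+1 < n)%N ->
    ~~ cancels (nth (true, true) w i) (nth (true, true) w i.+1).
  move=> lt; move: red; rewrite /reduced => /(sortedP (true, true)) /(_ i lt).
  by rewrite /cancels.
(* The letter at position i must carry i to i + 1. If it is inverted, the underlying generator must
   carry i + 1 to i, so source and target are exchanged. *)
pose src i := (i + (nth (true, true) w i).2)%N.
pose tgt i := (i + ~~ (nth (true, true) w i).2)%N.
have ext x : exists f : {perm 'I_n.+1}, forall i, (i < n)%N ->
    (nth (true, true) w i).1 = x -> f (inord (src i)) = inord (tgt i).
  pose r := [seq (inord (src i) : 'I_n.+1, inord (tgt i) : 'I_n.+1)
            | i <- iota 0 n & (nth (true, true) w i).1 == x].
  (* Two constraints on one generator can share a source or a target only at neighbouring positions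
     with opposite exponents, and [consec] excludes these. *)
  have aux g : (forall i, g i = src i) \/ (forall i, g i = tgt i) ->
      uniq [seq (inord (g i) : 'I_n.+1)
           | i <- iota 0 n & (nth (true, true) w i).1 == x].
    move=> gE; rewrite map_inj_in_uniq ?filter_uniq ?iota_uniq // => i j.
    rewrite !mem_filter !mem_iota !add0n /= => /andP[/eqP xi ni] /andP[/eqP xj nj].
    have bound k : (k < n)%N -> (g k < n.+1)%N.
      case: gE => -> kn; rewrite ltnS ?/src ?/tgt;
        by case: ((nth (true, true) w k).2); rewrite /= ?addn1 ?addn0 ?(ltnW kn).
    move=> /(congr1 val) /=; rewrite !inordK ?bound // => gij.
    wlog lt : i j xi ni xj nj gij / (i < j)%N.
      move=> H; case: (ltngtP i j) => [lt|lt|//]; first exact: H gij lt.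
      by apply/esym; apply: H (esym gij) lt.
    have [/esym E di dj] : [/\ i.+1 = j,
        (nth (true, true) w i).2 = ~~ (nth (true, true) w j).2 & True].
      by move: gij; case: gE => gE; rewrite !gE ?/src ?/tgt;
        case: ((nth (true, true) w i).2); case: ((nth (true, true) w j).2);
        rewrite /= ?addn0 ?addn1 => gij; split=> //; lia.
    have /negP[] := consec i ltac:(by rewrite -E).
    by rewrite -E /cancels xi xj eqxx /= di; case: (_.2).
  have [| |f fr] := @perm_extension _ r.
  - by rewrite -map_comp; apply: aux; left.
  - by rewrite -map_comp; apply: aux; right.
  exists f => i ni xi; apply: (fr (inord (src i), inord (tgt i))).
  by apply: map_f; rewrite mem_filter mem_iota xi eqxx.
have [a aP] := ext false; have [b bP] := ext true.
exists a, b => W1.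
have step i : (i < n)%N ->
    gletter a b (nth (true, true) w i) (inord i) = inord i.+1.
  move=> ni; rewrite /gletter; move: (aP i ni) (bP i ni).
  rewrite /src /tgt; case: (nth (true, true) w i) => [[] []] /=;
    rewrite ?addn0 ?addn1 => Ha Hb.
  - by rewrite -(Hb erefl) permK.
  - exact: Hb.
  - by rewrite -(Ha erefl) permK.
  - exact: Ha.
have run k : (k <= n)%N -> gword a b (take k w) (inord 0) = inord k.
  elim: k => [|k IH] kn; first by rewrite take0 /gword big_nil perm1.
  rewrite (take_nth (true, true)) // -cats1 gword_cat permM IH 1?ltnW //.
  by rewrite gword_cons /gword big_nil mulg1 step.
have := run n (leqnn n); rewrite take_size W1 perm1.
move=> /(congr1 val) /=; rewrite !inordK // => /esym/size0nil; exact: w0.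
Qed.

(** * Words in matrices up to sign *)

Section Words.
Variable R : realType.
Local Notation C := R[i].
Local Notation mx := 'M[C]_2.
Implicit Types (M N X Y A B h g : mx) (G : set mx) (w : seq (bool * bool)).

Lemma eq_pm_refl M : eq_pm M M. Proof. by left. Qed.

Lemma eq_pm_sym M N : eq_pm M N -> eq_pm N M.
Proof. by case=> ->; [left | right; rewrite opprK]. Qed.

Lemma eq_pm_trans N M M' : eq_pm M N -> eq_pm N M' -> eq_pm M M'.
Proof.
by case=> ->; case=> ->; [left | right | right | left]; rewrite ?opprK.
Qed.

Lemma eq_pmM M M' N N' : eq_pm M M' -> eq_pm N N' -> eq_pm (M * N) (M' * N').
Proof.
by case=> ->; case=> ->; [left | right | right | left];
  rewrite ?mulNr ?mulrN ?opprK.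
Qed.

Lemma eq_pmV M N : eq_pm M N -> eq_pm M^-1 N^-1.
Proof. by case=> ->; [left | right; rewrite invrN]. Qed.

Lemma eq_pmX M N n : eq_pm M N -> eq_pm (M ^+ n) (N ^+ n).
Proof.
move=> e; elim: n => [|n IH]; first by rewrite !expr0; left.
by rewrite !exprS; apply: eq_pmM.
Qed.

Lemma det1_unit M : \det M = 1 -> M \is a GRing.unit.
Proof. by move=> d; rewrite -[_ \is a _]/(M \in unitmx) unitmxE d unitr1. Qed.

Lemma det1V M : \det M = 1 -> \det M^-1 = 1.
Proof. by move=> d; rewrite -[M^-1]/(invmx M) det_inv d invr1. Qed.

Section Subgroup.
Variable G : set mx.
Hypothesis sG : psl_subgroup G.

Lemma psl_det M : G M -> \det M = 1. Proof. by case: sG => H _ _ _; exact: H. Qed.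

Lemma psl_unit M : G M -> M \is a GRing.unit.
Proof. by move=> /psl_det/det1_unit. Qed.

Lemma psl1 : G 1. Proof. by case: sG. Qed.

Lemma psl_pm M N : eq_pm M N -> G N -> G M.
Proof. by case=> -> // GN; case: sG => _ _ H _; exact: H. Qed.

Lemma pslV M : G M -> G M^-1.
Proof. by move=> GM; case: sG => _ G1 _ H; rewrite -[_^-1]mul1r; apply: H. Qed.

Lemma pslM M N : G M -> G N -> G (M * N).
Proof.
by move=> GM /pslV GN; case: sG => _ _ _ H; rewrite -(invrK N); apply: H.
Qed.

Lemma pslX M n : G M -> G (M ^+ n).
Proof.
by move=> GM; elim: n => [|n IH]; rewrite ?expr0 ?exprS; [exact: psl1|exact: pslM].
Qed.

End Subgroup.

Lemma word_cons X Y l w : word X Y (l :: w) = letter X Y l * word X Y w.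
Proof. by rewrite /word big_cons. Qed.

Lemma word_nil X Y : word X Y [::] = 1.
Proof. by rewrite /word big_nil. Qed.

Lemma word1 X Y l : word X Y [:: l] = letter X Y l.
Proof. by rewrite word_cons word_nil mulr1. Qed.

Lemma word_cat X Y w w' : word X Y (w ++ w') = word X Y w * word X Y w'.
Proof. by rewrite /word big_cat. Qed.

Lemma psl_word G X Y w : psl_subgroup G -> G X -> G Y -> G (word X Y w).
Proof.
move=> sG GX GY; elim: w => [|l w IH]; first by rewrite word_nil; exact: psl1.
rewrite word_cons; apply: (pslM sG) => //.
by case: l => [[] []]; rewrite /letter /=; try apply: (pslV sG).
Qed.

Section Units.
Variables X Y : mx.
Hypotheses (uX : X \is a GRing.unit) (uY : Y \is a GRing.unit).

Lemma letter_unit l : letter X Y l \is a GRing.unit.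
Proof. by case: l => [[] []]; rewrite /letter /= ?unitrV. Qed.

Lemma letter_flip l : letter X Y (flipl l) = (letter X Y l)^-1.
Proof. by case: l => [x []]; rewrite /letter /= ?invrK. Qed.

Lemma word_unit w : word X Y w \is a GRing.unit.
Proof.
elim: w => [|l w IH]; first by rewrite word_nil unitr1.
by rewrite word_cons unitrMr ?letter_unit.
Qed.

Lemma word_inv w : word X Y (winv w) = (word X Y w)^-1.
Proof.
elim: w => [|l w IH]; first by rewrite !word_nil invr1.
rewrite /winv /= rev_cons -cats1 word_cat -/(winv w) IH word1 word_cons.
by rewrite invrM ?letter_unit ?word_unit // letter_flip.
Qed.

Lemma word_reduce w : word X Y (reduce w) = word X Y w.
Proof.
elim: w => //= l w IH; rewrite word_cons -IH.
case: (reduce w) => [|m w'] /=; first by rewrite word_cons.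
case: ifP => [|_]; last by rewrite !word_cons.
by rewrite cancelsE => /eqP ->; rewrite word_cons letter_flip mulVKr ?letter_unit.
Qed.

Lemma word_subst A B u v w : eq_pm A (word X Y u) -> eq_pm B (word X Y v) ->
  eq_pm (word X Y (subst u v w)) (word A B w).
Proof.
move=> eA eB; elim: w => [|[x e] w IH]; first by rewrite !word_nil; left.
rewrite /subst /= word_cat -/(subst u v w) word_cons; apply: eq_pmM IH.
case: x e => [] [] /=; rewrite /letter /= ?word_inv; first [apply: eq_pmV|idtac];
  exact: eq_pm_sym.
Qed.

End Units.

Definition freely X Y : Prop :=
  forall w, reduced w -> w <> [::] -> ~ eq_pm (word X Y w) 1.

Lemma freely_reduce X Y w : X \is a GRing.unit -> Y \is a GRing.unit ->
  freely X Y -> eq_pm (word X Y w) 1 -> reduce w = [::].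
Proof.
move=> uX uY fXY; rewrite -word_reduce //; have := reduced_reduce w.
by case: (reduce w) => // l w' r /fXY[].
Qed.

Lemma freely_gword (gT : finGroupType) (a b : gT) X Y w :
  X \is a GRing.unit -> Y \is a GRing.unit ->
  freely X Y -> eq_pm (word X Y w) 1 -> gword a b w = 1%g.
Proof.
move=> uX uY fXY /(freely_reduce uX uY fXY) r.
by rewrite -gword_reduce r /gword big_nil.
Qed.

(* Hopf property: an epimorphism between free groups of rank two induces an
   injection on the finite sets Hom(F, S_n), hence a bijection, and the
   homomorphisms to the groups S_n separate reduced words from 1. *)
Lemma generators_freely G X Y A B : psl_subgroup G ->
  generators G X Y -> freely X Y -> generators G A B -> freely A B.
Proof.
move=> sG [GX GY gXY] fXY [GA GB gAB] w rw w0 w1.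
have [uX uY uA uB] : [/\ X \is a GRing.unit, Y \is a GRing.unit,
    A \is a GRing.unit & B \is a GRing.unit].
  by split; apply: (psl_unit sG).
have [u eA] := gXY _ GA; have [v eB] := gXY _ GB.
have [u' eX] := gAB _ GX; have [v' eY] := gAB _ GY.
have [a [b ab1]] := reduced_gword_neq1 rw w0.
pose T : finGroupType := {perm (ordinal (size w).+1)}; rewrite -/T in a b ab1.
(* A pair in [T * T] is a homomorphism given by its values at X and Y, and [Phi] takes its values at
   A and B. Once [Phi] is onto, (a, b) comes from such a homomorphism, which kills [w] because [w]
   is trivial in G. *)
pose Phi (c : T * T) := (gword c.1 c.2 u, gword c.1 c.2 v).
pose Psi (c : T * T) := (gword c.1 c.2 u', gword c.1 c.2 v').
have inv c d x z (y : seq (bool * bool)) : eq_pm z (word A B y) -> letter X Y x = z ->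
    gword (gword c d u) (gword c d v) y = gletter c d x :> T.
  move=> ez ex; rewrite -gword_subst.
  have := @freely_gword T c d X Y (subst u v y ++ [:: flipl x]) uX uY fXY.
  rewrite gword_cat gword_cons gletter_flip {2}/gword big_nil mulg1 => H.
  apply/eqP; rewrite eq_mulgV1; apply/eqP/H.
  rewrite word_cat word1 letter_flip ex.
  have uz : z \is a GRing.unit by rewrite -ex letter_unit.
  rewrite -(divrr uz); apply: eq_pmM (eq_pm_refl _).
  exact: eq_pm_trans (word_subst uX uY _ eA eB) (eq_pm_sym ez).
have PhiK : cancel Phi Psi.
  move=> [c d]; rewrite /Phi /Psi /=; congr pair.
    by rewrite (inv c d (false, false) X).
  by rewrite (inv c d (true, false) Y).
have [Phi' _ Phi'K] := injF_bij (can_inj PhiK).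
apply: ab1; move: (Phi'K (a, b)); case: (Phi' (a, b)) => c d [<- <-].
rewrite -gword_subst; apply: (freely_gword _ _ uX uY fXY).
exact: eq_pm_trans (word_subst uX uY _ eA eB) w1.
Qed.

Lemma reduced_cat w w' : reduced w -> reduced w' ->
  (forall l m, w != [::] -> w' != [::] -> last l w = l -> head m w' = m ->
     ~~ cancels l m) ->
  reduced (w ++ w').
Proof.
case: w => // l w rw; case: w' => [|m w' rw' H]; first by rewrite cats0.
rewrite /reduced /= cat_path; apply/andP; split=> //=; apply/andP; split=> //.
by apply: (H (last l w) m) => //=; case: w {rw H}.
Qed.

Lemma reduced_catl w w' : reduced (w ++ w') -> reduced w.
Proof. by case: w => // l w; rewrite /reduced /= cat_path => /andP[]. Qed.

Lemma reduced_catr w w' : reduced (w ++ w') -> reduced w'.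
Proof.
case: w => // l w; rewrite /reduced /= cat_path => /andP[_].
by case: w' => //= m w' /andP[].
Qed.

Lemma reduced_map_flip w : reduced w -> reduced (map flipl w).
Proof.
case: w => // l w; rewrite /reduced /= path_map.
by apply: sub_path => -[[] []] [[] []].
Qed.

(** If the last and first letters do not cancel, every power of the word is reduced as written and
    so nontrivial. If they cancel, conjugating by the last letter gives a word shorter by two with
    the same torsion, empty by induction; the original word is then a letter next to its inverse,
    hence not reduced. *)
Lemma freely_torsion X Y w n : X \is a GRing.unit -> Y \is a GRing.unit ->
  freely X Y -> reduced w -> eq_pm (word X Y w ^+ n.+1) 1 -> w = [::].
Proof.
move=> uX uY fXY; have [k] := ubnP (size w); elim: k => // k IH in w *.
move=> sz rw wn; case: (eqVneq w [::]) => // w0; exfalso.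
case: (boolP (cancels (last (true, true) w) (head (true, true) w))) => [E|].
  case: w w0 sz rw wn E => // l w _; elim/last_ind: w => [|w m _] sz rw wn.
    by rewrite /= cancelsE; case: l {sz rw wn} => [[] []].
  rewrite /= last_rcons cancelsE => /eqP lm; subst l.
  have w1 : w = [::].
    apply: IH.
    - by move: sz; rewrite /= size_rcons; lia.
    - by move: rw; rewrite -cats1 -cat1s => /reduced_catr/reduced_catl.
    have E : word X Y (flipl m :: rcons w m) =
        (letter X Y m)^-1 * word X Y w * letter X Y m.
      by rewrite word_cons letter_flip -cats1 word_cat word1 mulrA.
    have um := letter_unit uX uY m.
    have EX j : (word X Y (flipl m :: rcons w m)) ^+ j =
        (letter X Y m)^-1 * word X Y w ^+ j * letter X Y m.
      elim: j => [|j IHj]; first by rewrite !expr0 mulr1 mulVr.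
      by rewrite !exprS IHj E !mulrA mulrK.
    move: wn; rewrite EX => wn.
    have := eq_pmM (eq_pmM (eq_pm_refl (letter X Y m)) wn)
                   (eq_pm_refl (letter X Y m)^-1).
    by rewrite !mulrA mulr1 divrr // mul1r mulrK.
  by move: rw; rewrite w1; clear; case: m => [[] []].
move=> nc; pose W j := flatten (nseq j w).
have WE j : word X Y (W j) = word X Y w ^+ j.
  by elim: j => [|j IHj]; rewrite ?word_nil ?expr0 // exprS /W /= word_cat -IHj.
have W0 j : W j.+1 != [::] by rewrite /W /=; case: (w) w0.
have hW j m : head m (W j.+1) = head m w by rewrite /W /=; case: (w) w0.
have Wr j : reduced (W j).
  elim: j => // j IHj; rewrite -[W _]/(w ++ W j); apply: reduced_cat => // l m _.
  case: j IHj => [//|j] IHj _; rewrite hW => <- <-.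
  by move: nc; case: (w) w0.
apply: (fXY (W n.+1)) => //; first exact/eqP.
by rewrite WE.
Qed.

(** At the junction of [w] and [map flipl w] the last letter of [w] meets the inverse of its first.
    If these two letters of [w] differ, the concatenation is reduced, against the relation. If they
    agree, conjugating the relation by that letter strips both ends. *)
Lemma palindrome X Y w : X \is a GRing.unit -> Y \is a GRing.unit ->
  freely X Y -> reduced w -> eq_pm (word X Y (w ++ map flipl w)) 1 ->
  exists v m, (size m <= 1)%N /\ w = v ++ m ++ rev v.
Proof.
move=> uX uY fXY; have [k] := ubnP (size w); elim: k => // k IH in w *.
case: w => [|l w]; first by exists [::], [::].
elim/last_ind: w => [|w m _] sz rw w1; first by exists [::], [:: l].
have [lm|nlm] := eqVneq m l; last first.
  exfalso; apply: (fXY _ _ _ w1) => //; apply: reduced_cat => //.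
    exact: reduced_map_flip.
  move=> l' m' _ _; rewrite /= last_rcons => <- <-.
  by rewrite cancelsE; apply: contraNneq nlm => /(can_inj fliplK) ->.
subst m; have um := letter_unit uX uY l.
have [|||v [m [sm E]]] := IH w.
- by move: sz; rewrite /= size_rcons; lia.
- by move: rw; rewrite -cats1 -cat1s => /reduced_catr/reduced_catl.
- have := eq_pmM (eq_pmM (eq_pm_refl (letter X Y l)^-1) w1)
                 (eq_pm_refl (letter X Y l)).
  rewrite mulr1 mulVr // -cats1 map_cons map_cat !word_cat !word_cons !word_cat.
  rewrite !word1 /= letter_flip !mulrA mulVr // mul1r.
  by rewrite mulrK // mulrVK // word1 letter_flip mulrVK.
exists (l :: v), m; split=> //; rewrite E rev_cons.
by rewrite -!cats1 /= !catA.
Qed.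

End Words.

(** * Involutions inverting a free basis *)

Section HalfTurns.
Variable R : realType.
Local Notation C := R[i].
Local Notation mx := 'M[C]_2.
Implicit Types (M N X Y A B h g : mx) (G : set mx) (w : seq (bool * bool)).

Lemma involution_inv h : h \is a GRing.unit -> eq_pm (h * h) 1 -> eq_pm h^-1 h.
Proof.
move=> uh /(eq_pmM (eq_pm_refl h^-1)).
by rewrite mulr1 mulKr // => /eq_pm_sym.
Qed.

Variables (G : set mx) (A B hp hA hB : mx).
Hypotheses (sG : psl_subgroup G) (gAB : generators G A B) (fAB : freely A B).
Hypotheses (up : hp \is a GRing.unit) (uhA : hA \is a GRing.unit)
  (uhB : hB \is a GRing.unit).
Hypotheses (hp2 : eq_pm (hp * hp) 1) (hA2 : eq_pm (hA * hA) 1)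
  (hB2 : eq_pm (hB * hB) 1).
Hypotheses (AE : eq_pm A (hp * hA)) (BE : eq_pm B (hp * hB)).

(** Up to sign it identifies [hA] with [A^-1 hp] and [hB] with [B^-1 hp], elements of the coset G
    hp. *)
Lemma involution_letter X k : k \is a GRing.unit -> eq_pm (k * k) 1 ->
  eq_pm X (hp * k) -> eq_pm (hp * X) k /\ eq_pm (X^-1 * hp) k.
Proof.
move=> uk k2 XE; split.
  have := eq_pmM (eq_pm_refl hp) XE; move=> /eq_pm_trans; apply.
  by rewrite mulrA -[X in eq_pm _ X]mul1r; exact: eq_pmM (eq_pm_refl _).
have := eq_pmM (eq_pmV XE) (eq_pm_refl hp); rewrite invrM // mulrVK // => e.
exact: eq_pm_trans e (involution_inv uk k2).
Qed.

Lemma flip_word w : eq_pm (hp * word A B w) (word A B (map flipl w) * hp).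
Proof.
elim: w => [|l w IH]; first by rewrite !word_nil mulr1 mul1r; left.
suff E : eq_pm (hp * letter A B l) (letter A B (flipl l) * hp).
  rewrite /= !word_cons mulrA.
  apply: eq_pm_trans (eq_pmM E (eq_pm_refl _)) _.
  by rewrite -!mulrA; apply: eq_pmM IH; left.
have aux X k : k \is a GRing.unit -> eq_pm (k * k) 1 -> eq_pm X (hp * k) ->
    eq_pm (hp * X) (X^-1 * hp) /\ eq_pm (hp * X^-1) (X * hp).
  move=> uk k2 XE; have [e1 e2] := involution_letter uk k2 XE.
  have e := eq_pm_trans e1 (eq_pm_sym e2); split=> //.
  have uX : X \is a GRing.unit.
    by case: XE => ->; rewrite ?unitrN unitrMr.
  have := eq_pmM (eq_pmM (eq_pm_refl X) e) (eq_pm_refl X^-1).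
  by rewrite !mulrA divrr // mul1r mulrK // => e'; exact: eq_pm_sym e'.
have [a1 a2] := aux _ _ uhA hA2 AE; have [b1 b2] := aux _ _ uhB hB2 BE.
by case: l => [[] []]; [exact: b2|exact: b1|exact: a2|exact: a1].
Qed.

Lemma half_turn_normalizes g : G g -> exists2 k, G k & eq_pm (hp * g) (k * hp).
Proof.
case: gAB => GA GB gw /gw[w e]; exists (word A B (map flipl w)).
  exact: psl_word.
exact: eq_pm_trans (eq_pmM (eq_pm_refl _) e) (flip_word w).
Qed.

Lemma half_turn_normalizesV g : G g -> exists2 k, G k & eq_pm (g * hp) (hp * k).
Proof.
move=> /half_turn_normalizes[k Gk e]; exists k => //.
have ip := involution_inv up hp2.
have := eq_pmM (eq_pmM (eq_pm_refl hp^-1) e) (eq_pm_refl hp^-1).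
rewrite mulKr // mulrA mulrK // => e'.
apply: eq_pm_trans (eq_pmM (eq_pm_refl g) (eq_pm_sym ip)) _.
exact: eq_pm_trans e' (eq_pmM ip (eq_pm_refl k)).
Qed.

(* If g hp has order two, then g, as a reduced word in A and B, is a palindrome
   v m v^rev with m empty or a letter, and g hp = v (m hp) v^-1. *)
Lemma involution_conjugate g : G g -> eq_pm (g * hp * (g * hp)) 1 ->
  exists2 v, G v & exists k, (k = hp \/ k = hA \/ k = hB) /\
    eq_pm (g * hp * v) (v * k).
Proof.
move=> Gg g2; case: (gAB) => GA GB gw.
have [uA uB] : A \is a GRing.unit /\ B \is a GRing.unit.
  by split; apply: (psl_unit sG).
have [w0 gw0] := gw _ Gg.
have gE : eq_pm g (word A B (reduce w0)) by rewrite word_reduce.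
move: (reduce w0) (reduced_reduce w0) gE => {w0 gw0} w rw gE.
have [v [m [sm wE]]] : exists v m, (size m <= 1)%N /\ w = v ++ m ++ rev v.
  apply: palindrome fAB rw _ => //; rewrite word_cat.
  apply: eq_pm_trans g2.
  rewrite -mulrA; apply: eq_pmM (eq_pm_sym gE) _.
  have e1 := eq_pmM (eq_pm_refl hp) (eq_pmM gE (eq_pm_refl hp)).
  apply: eq_pm_sym; apply: eq_pm_trans e1 _.
  rewrite mulrA; apply: eq_pm_trans (eq_pmM (flip_word w) (eq_pm_refl _)) _.
  by rewrite -mulrA -[X in eq_pm _ X]mulr1; exact: eq_pmM (eq_pm_refl _) hp2.
have Gword u : G (word A B u) by exact: psl_word.
(* Moving [hp] to the left across [rev v] inverts each letter, which turns [rev v] into the inverse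
   of [v]. *)
have revE : eq_pm (word A B (rev v) * hp * word A B v) hp.
  have e := flip_word (map flipl (rev v)).
  rewrite (mapK fliplK) in e.
  apply: eq_pm_trans (eq_pmM (eq_pm_sym e) (eq_pm_refl _)) _.
  by rewrite map_rev -/(winv v) word_inv // mulrVK ?word_unit //; left.
have step : eq_pm (g * hp * word A B v) (word A B v * (word A B m * hp)).
  apply: eq_pm_trans (eq_pmM (eq_pmM gE (eq_pm_refl _)) (eq_pm_refl _)) _.
  rewrite wE !word_cat -!mulrA; apply: eq_pmM; first by left.
  by apply: eq_pmM; [left|rewrite mulrA].
have [a1 a2] := involution_letter uhA hA2 AE.
have [b1 b2] := involution_letter uhB hB2 BE.
case: m sm wE step => [|l [|//]] _ _.
  rewrite word_nil mul1r => step; exists (word A B v) => //.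
  by exists hp; split=> //; left.
rewrite word1 => step.
(* An inverse letter gives X^-1 hp = k at once. A positive letter gives X hp = X k X^-1, hence the
   extra factor [X] in the conjugating element. *)
have aux X k : G X -> k = hA \/ k = hB -> k \is a GRing.unit ->
    eq_pm (k * k) 1 -> eq_pm X (hp * k) -> eq_pm (X^-1 * hp) k ->
    eq_pm (g * hp * word A B v) (word A B v * (X * hp)) ->
  exists2 v, G v & exists k, (k = hp \/ k = hA \/ k = hB) /\
    eq_pm (g * hp * v) (v * k).
  move=> GX kE uk k2 XE e st; exists (word A B v * X); first exact: pslM.
  exists k; split; first by right.
  rewrite mulrA; apply: eq_pm_trans (eq_pmM st (eq_pm_refl _)) _.
  rewrite -!mulrA; do 2 (apply: eq_pmM; first by left).
  exact: (involution_letter uk k2 XE).1.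
case: l step => [[] []]; rewrite /letter /= => step.
- exists (word A B v) => //; exists hB; split; first by right; right.
  by apply: eq_pm_trans step _; apply: eq_pmM b2; left.
- by apply: (aux B hB) step => //; right.
- exists (word A B v) => //; exists hA; split; first by right; left.
  by apply: eq_pm_trans step _; apply: eq_pmM a2; left.
- by apply: (aux A hA) step => //; left.
Qed.

End HalfTurns.

(** * The hyperboloid model *)

Section Hyperboloid.
Variable R : realType.
Implicit Types (x y w : point3 R) (c : R -> point3 R) (s t : R)
  (u v a b : 'rV[R]_4).

Local Notation i0 := (@Ordinal 4 0 isT).
Local Notation i1 := (@Ordinal 4 1 isT).
Local Notation i2 := (@Ordinal 4 2 isT).
Local Notation i3 := (@Ordinal 4 3 isT).

Definition mform u v : R :=
  u 0 i0 * v 0 i0 - u 0 i1 * v 0 i1 - u 0 i2 * v 0 i2 - u 0 i3 * v 0 i3.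

Lemma mformC u v : mform u v = mform v u.
Proof. by rewrite /mform; ring. Qed.

Lemma mformDl u v a : mform (u + v) a = mform u a + mform v a.
Proof. by rewrite /mform !mxE; ring. Qed.

Lemma mformZl k u a : mform (k *: u) a = k * mform u a.
Proof. by rewrite /mform !mxE; ring. Qed.

Lemma mformNl u a : mform (- u) a = - mform u a.
Proof. by rewrite /mform !mxE; ring. Qed.

Lemma mformDr u v a : mform a (u + v) = mform a u + mform a v.
Proof. by rewrite /mform !mxE; ring. Qed.

Lemma mformZr k u a : mform a (k *: u) = k * mform a u.
Proof. by rewrite /mform !mxE; ring. Qed.

Lemma mformNr u a : mform a (- u) = - mform a u.
Proof. by rewrite /mform !mxE; ring. Qed.

Definition mformE :=
  (mformDl, mformDr, mformNl, mformNr, mformZl, mformZr).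

Lemma vec4P u v : u 0 i0 = v 0 i0 -> u 0 i1 = v 0 i1 -> u 0 i2 = v 0 i2 ->
  u 0 i3 = v 0 i3 -> u = v.
Proof.
move=> e0 e1 e2 e3; apply/rowP => -[[|[|[|[|//]]]] i4];
  [move: e0 | move: e1 | move: e2 | move: e3];
  by congr (_ = _); congr (_ _ _); apply: val_inj.
Qed.

(** The form has signature (1, 3), so it is negative definite on the orthogonal complement of a
    timelike vector; this is Cauchy-Schwarz in the three space coordinates. Equalities of lifts are
    later proved by pairing their difference with a timelike vector and with itself. *)
Lemma mform_definite u v :
  0 < mform u u -> mform u v = 0 -> 0 <= mform v v -> v = 0.
Proof.
rewrite /mform; move=> uu uv vv.
have v0 : v 0 i0 = 0.
  apply/eqP; rewrite -sqrf_eq0 eq_le sqr_ge0 andbT.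
  move: (u 0 i0) (u 0 i1) (u 0 i2) (u 0 i3) (v 0 i0) (v 0 i1) (v 0 i2) (v 0 i3)
    uu uv vv => p q r s p' q' r' s' uu uv vv.
  have e : p * p' = q * q' + r * r' + s * s' by lra.
  have l1 : 0 <= (q * r' - r * q') ^+ 2 + (q * s' - s * q') ^+ 2
    + (r * s' - s * r') ^+ 2 by rewrite !addr_ge0 ?sqr_ge0.
  have l2 : (p * p') ^+ 2 <= (q ^+ 2 + r ^+ 2 + s ^+ 2) * (q' ^+ 2 + r' ^+ 2 + s' ^+ 2).
    rewrite e -subr_ge0; apply: le_trans l1 _; rewrite le_eqVlt; apply/orP; left.
    by apply/eqP; ring.
  have l3 : (q ^+ 2 + r ^+ 2 + s ^+ 2) * (q' ^+ 2 + r' ^+ 2 + s' ^+ 2) <=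
     (q ^+ 2 + r ^+ 2 + s ^+ 2) * p' ^+ 2.
    by apply: ler_wpM2l; [rewrite !addr_ge0 ?sqr_ge0|lra].
  have l4 : (p ^+ 2 - (q ^+ 2 + r ^+ 2 + s ^+ 2)) * p' ^+ 2 <= 0.
    by rewrite mulrBl subr_le0 -exprMn; apply: le_trans l2 l3.
  have : 0 < p ^+ 2 - (q ^+ 2 + r ^+ 2 + s ^+ 2) by lra.
  by move=> k; rewrite pmulr_rle0 in l4.
move: vv; rewrite v0 mul0r => vv.
have := sqr_ge0 (v 0 i1); have := sqr_ge0 (v 0 i2); have := sqr_ge0 (v 0 i3).
move=> s3 s2 s1.
by apply: vec4P; rewrite ?mxE //;
      apply/eqP; rewrite -sqrf_eq0 eq_le sqr_ge0 andbT; lra.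
Qed.

(** The multiple of [a] is chosen to cancel the time coordinate of [b]. The difference is still
    null, and a null vector without time coordinate is zero. *)
Lemma mform_null a b : mform a a = 0 -> mform b b = 0 -> mform a b = 0 ->
  a != 0 -> exists k, b = k *: a.
Proof.
move=> aa bb ab a0.
have a00 : a 0 i0 != 0.
  apply: contraNneq a0 => a00; apply/eqP.
  move: aa; rewrite /mform a00 mul0r => aa.
  have := sqr_ge0 (a 0 i1); have := sqr_ge0 (a 0 i2); have := sqr_ge0 (a 0 i3).
  move=> s3 s2 s1; apply: vec4P; rewrite ?mxE //;
    apply/eqP; rewrite -sqrf_eq0 eq_le sqr_ge0 andbT; lra.
exists (b 0 i0 / a 0 i0); apply/eqP; rewrite -subr_eq0; apply/eqP.
set k := _ / _; set v := b - _.
have vv : mform v v = 0 by rewrite /v !mformE (mformC b a) bb ab aa; ring.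
have v0 : v 0 i0 = 0 by rewrite /v /k !mxE; field.
move: vv; rewrite /mform v0 mul0r => vv.
have := sqr_ge0 (v 0 i1); have := sqr_ge0 (v 0 i2); have := sqr_ge0 (v 0 i3).
move=> s3 s2 s1; apply: vec4P; rewrite ?[(0 : 'rV_4) _ _]mxE //;
    apply/eqP; rewrite -sqrf_eq0 eq_le sqr_ge0 andbT; lra.
Qed.

Definition hlift x : 'rV[R]_4 := \row_i nth 0 [:: (enorm2 x + 1) / (2 * height x);
  x.1.1 / height x; x.1.2 / height x; (enorm2 x - 1) / (2 * height x)] i.

Definition normal : 'rV[R]_4 := delta_mx 0 i3.

(** This is the hyperbolic sine of the signed distance to the plane, positive outside the unit
    sphere. *)
Definition ncoord x : R := hlift x 0 i3.

Lemma mform_normal u : mform u normal = - u 0 i3.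
Proof. by rewrite /mform /normal !mxE /=; ring. Qed.

Lemma mform_hlift x y : H3 x -> H3 y ->
  mform (hlift x) (hlift y) = 1 + edist2 x y / (2 * height x * height y).
Proof.
case: x y => [[a b] h] [[a' b'] h']; rewrite /H3 /= => h0 h'0.
rewrite /mform /hlift !mxE /= /enorm2 /edist2 /sqmod /= /height /= in h0 h'0 *.
by field; rewrite !gt_eqF.
Qed.

Lemma hlift_inj x y : H3 x -> H3 y -> hlift x = hlift y -> x = y.
Proof.
move=> Hx Hy e; have := mform_hlift Hx Hy; rewrite e mform_hlift //.
have -> : edist2 y y = 0 by rewrite /edist2 /sqmod /= !subrr; ring.
move: Hx Hy {e}; case: x y => [[a b] h] [[a' b'] h'].
rewrite /H3 /height /= => h0 h'0.
rewrite mul0r => /addrI/esym/eqP; rewrite mulf_eq0 invr_eq0 !mulf_eq0.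
rewrite !(gt_eqF h0) !(gt_eqF h'0) pnatr_eq0 !orbF /edist2 /sqmod /= => /eqP e.
have := sqr_ge0 (a - a'); have := sqr_ge0 (b - b'); have := sqr_ge0 (h - h').
move=> s3 s2 s1.
have ea : a = a' by apply/eqP; rewrite -subr_eq0 -sqrf_eq0 eq_le sqr_ge0 andbT; lra.
have eb : b = b' by apply/eqP; rewrite -subr_eq0 -sqrf_eq0 eq_le sqr_ge0 andbT; lra.
have eh : h = h' by apply/eqP; rewrite -subr_eq0 -sqrf_eq0 eq_le sqr_ge0 andbT; lra.
by rewrite ea eb eh.
Qed.

Lemma edist2_ge0 x y : 0 <= edist2 x y.
Proof. by rewrite /edist2 /sqmod !addr_ge0 ?sqr_ge0. Qed.

Lemma mform_hlift_ge1 x y : H3 x -> H3 y -> 1 <= mform (hlift x) (hlift y).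
Proof.
move=> Hx Hy; rewrite mform_hlift // lerDl divr_ge0 ?edist2_ge0 //.
by rewrite !mulr_ge0 // ltW.
Qed.

Lemma mform_hliftxx x : H3 x -> mform (hlift x) (hlift x) = 1.
Proof.
move=> Hx; rewrite mform_hlift //; have -> : edist2 x x = 0.
  by rewrite /edist2 /sqmod /= !subrr; ring.
by rewrite mul0r addr0.
Qed.

Lemma mform_hlift1 x y : H3 x -> H3 y -> mform (hlift x) (hlift y) = 1 -> x = y.
Proof.
move=> Hx Hy e; apply: hlift_inj => //; apply/eqP; rewrite -subr_eq0; apply/eqP.
by apply: (@mform_definite (hlift x)); rewrite ?mform_hliftxx // !mformE
  ?mform_hliftxx // ?(mformC _ (hlift x)) e; lra.
Qed.

Lemma coshR_ge1 t : 1 <= coshR t.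
Proof.
have [h0 h1] : 0 < expR t /\ 0 < expR (- t) by rewrite !expR_gt0.
have : expR t * expR (- t) = 1 by rewrite -expRD subrr expR0.
rewrite /coshR; move: (expR t) (expR (- t)) h0 h1 => u w u0 w0 e.
rewrite ler_pdivlMr // mul1r.
have : 0 <= (u - w) ^+ 2 by rewrite sqr_ge0.
by nra.
Qed.

Lemma arcoshR_aux t : 1 <= t -> 1 <= t + Num.sqrt (t ^+ 2 - 1).
Proof. by move=> t1; rewrite (le_trans t1) // lerDl sqrtr_ge0. Qed.

Lemma arcoshRK t : 1 <= t -> coshR (arcoshR t) = t.
Proof.
move=> t1; have m1 := arcoshR_aux t1; rewrite /coshR /arcoshR expRN lnK; last first.
  by rewrite posrE (lt_le_trans ltr01).
have q2 : Num.sqrt (t ^+ 2 - 1) ^+ 2 = t ^+ 2 - 1.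
  by rewrite sqr_sqrtr // subr_ge0 exprn_ege1.
move: (Num.sqrt _) q2 m1 => q q2 m1.
have k0 : t + q != 0 by rewrite gt_eqF // (lt_le_trans ltr01).
have -> : (t + q)^-1 = t - q.
  apply: (mulfI k0); rewrite divff //; transitivity (t ^+ 2 - q ^+ 2); last ring.
  by rewrite q2; ring.
by field.
Qed.

Lemma arcoshR_ge0 t : 1 <= t -> 0 <= arcoshR t.
Proof. by move=> t1; rewrite /arcoshR ln_ge0 ?arcoshR_aux. Qed.

Lemma ler_coshR s t : 0 <= s -> 0 <= t -> (coshR s <= coshR t) = (s <= t).
Proof.
have mono (x y : R) : 0 <= x -> x < y -> coshR x < coshR y.
  move=> x0 xy; rewrite /coshR ltr_pM2r ?invr_gt0 // -subr_gt0.
  have e1 : 1 <= expR x by rewrite -expR0 ler_expR.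
  have e2 : expR x < expR y by rewrite ltr_expR.
  rewrite !expRN; move: (expR x) (expR y) e1 e2 => p q e1 e2.
  have p0 : 0 < p by lra.
  have q0 : 0 < q by lra.
  have -> : q + q^-1 - (p + p^-1) = (q - p) * (p * q - 1) / (p * q).
    by field; rewrite !gt_eqF.
  by rewrite divr_gt0 ?mulr_gt0 ?subr_gt0 //; nra.
move=> s0 t0; case: (leP s t) => [|ts]; last by rewrite leNgt mono.
by rewrite le_eqVlt => /predU1P[->|/mono st]; rewrite ?lexx // ltW ?st.
Qed.

Lemma hdist_ge0 x y : H3 x -> H3 y -> 0 <= hdist x y.
Proof. by move=> Hx Hy; rewrite /hdist -mform_hlift // arcoshR_ge0 ?mform_hlift_ge1. Qed.

Lemma coshR_hdist x y : H3 x -> H3 y -> coshR (hdist x y) = mform (hlift x) (hlift y).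
Proof. by move=> Hx Hy; rewrite /hdist -mform_hlift // arcoshRK ?mform_hlift_ge1. Qed.

Lemma hdistE x y : H3 x -> H3 y -> hdist x y = arcoshR (mform (hlift x) (hlift y)).
Proof. by move=> Hx Hy; rewrite mform_hlift. Qed.

Lemma coshRN t : coshR (- t) = coshR t.
Proof. by rewrite /coshR opprK addrC. Qed.

Lemma sinhRN t : sinhR (- t) = - sinhR t.
Proof. by rewrite /sinhR opprK -mulNr opprB. Qed.

Lemma coshRD s t : coshR (s + t) = coshR s * coshR t + sinhR s * sinhR t.
Proof. by rewrite /coshR /sinhR opprD !expRD; field. Qed.

Lemma sinhRD s t : sinhR (s + t) = sinhR s * coshR t + coshR s * sinhR t.
Proof. by rewrite /coshR /sinhR opprD !expRD; field. Qed.

Lemma coshR_norm t : coshR `|t| = coshR t.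
Proof. by case: (ger0P t) => // _; rewrite coshRN. Qed.

Lemma sqr_coshR t : coshR t ^+ 2 = 1 + sinhR t ^+ 2.
Proof. by rewrite -(coshR_sinhR t) subrK. Qed.

Lemma sinhR_lt s t : s < t -> sinhR s < sinhR t.
Proof.
move=> st; rewrite /sinhR ltr_pM2r ?invr_gt0 //.
by apply: ltrD; rewrite ?ltr_expR // ltrN2 ltr_expR ltrN2.
Qed.

Lemma sinhR_inj : injective (@sinhR R).
Proof.
move=> s t e; have [/sinhR_lt|/sinhR_lt|//] := ltgtP s t;
  by rewrite e ltxx.
Qed.

Lemma sinhR0 : sinhR (0 : R) = 0.
Proof. by rewrite /sinhR oppr0 expR0 subrr mul0r. Qed.

Lemma sinhR_gt0 t : 0 < t -> 0 < sinhR t.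
Proof. by move=> /sinhR_lt; rewrite sinhR0. Qed.

Lemma mform_geodesic c s t : geodesic c ->
  mform (hlift (c s)) (hlift (c t)) = coshR (s - t).
Proof. by case=> Hc dc; rewrite -coshR_hdist // dc coshR_norm. Qed.

(* The Gram matrix of the three lifts is that of three points of a geodesic;
   hence the combination is null, and orthogonal to a timelike vector. *)
Lemma collinear x y w s t : H3 x -> H3 y -> H3 w -> 
  mform (hlift x) (hlift w) = coshR s -> mform (hlift w) (hlift y) = coshR t ->
  mform (hlift x) (hlift y) = coshR (s + t) ->
  sinhR (s + t) *: hlift w = sinhR t *: hlift x + sinhR s *: hlift y.
Proof.
move=> Hx Hy Hw xw wy xy; apply/eqP; rewrite -subr_eq0; apply/eqP.
have cs := sqr_coshR s; have ct := sqr_coshR t.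
apply: (@mform_definite (hlift x)); rewrite ?mform_hliftxx // !mformE
  ?mform_hliftxx // ?(mformC (hlift w) (hlift x)) ?(mformC (hlift y)) xw ?wy xy
  coshRD sinhRD.
- have -> : (sinhR s * coshR t + coshR s * sinhR t) * coshR s -
    (sinhR t * 1 + sinhR s * (coshR s * coshR t + sinhR s * sinhR t)) =
    sinhR t * (coshR s ^+ 2 - sinhR s ^+ 2 - 1) by ring.
  by rewrite cs; ring.
- rewrite le_eqVlt; apply/orP; left; apply/eqP.
  transitivity (sinhR t ^+ 2 * (coshR s ^+ 2 - 1 - sinhR s ^+ 2) * -1
    - sinhR s ^+ 2 * (coshR t ^+ 2 - 1 - sinhR t ^+ 2)); last by ring.
  by rewrite cs ct; ring.
Qed.

End Hyperboloid.

(** * Geodesics and their ends *)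

Section Geodesics.
Variable R : realType.
Implicit Types (x y w : point3 R) (c : R -> point3 R) (s t p q l : R)
  (u v a b : 'rV[R]_4) (z : R[i]).

Local Notation i0 := (@Ordinal 4 0 isT).
Local Notation i1 := (@Ordinal 4 1 isT).
Local Notation i2 := (@Ordinal 4 2 isT).
Local Notation i3 := (@Ordinal 4 3 isT).

Lemma planeE x : plane x <-> H3 x /\ ncoord x = 0.
Proof.
rewrite /plane /ncoord /hlift mxE /=; split=> -[Hx e]; split=> //.
  by rewrite e subrr mul0r.
move/eqP: e; rewrite mulf_eq0 invr_eq0 mulf_eq0 pnatr_eq0 (gt_eqF Hx) !orbF.
by rewrite subr_eq0 => /eqP.
Qed.

Lemma hlift_V x s : plane x ->
  hlift (V x s) = coshR s *: hlift x + sinhR s *: normal R.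
Proof.
move=> Px; have d := V_den_gt0 s Px; have c2 := sqr_coshR s.
case: Px; rewrite /V; case: x d => [[a b] h]; rewrite /H3 /enorm2 /sqmod /= /height /=.
move=> d h0 e; have e2 : a ^+ 2 + b ^+ 2 = 1 - h ^+ 2 by rewrite -e; ring.
move: (coshR s) (sinhR s) d c2 => p q d c2.
have [dn hn] : p - h * q != 0 /\ h != 0 by rewrite !gt_eqF.
have E k : ((k * p * a) ^+ 2 + (k * p * b) ^+ 2) + (k * h) ^+ 2 =
    k ^+ 2 * (p ^+ 2 * (1 - h ^+ 2) + h ^+ 2) by rewrite -e2; ring.
have E1 : (a ^+ 2 + b ^+ 2) + h ^+ 2 = 1 by rewrite e2; ring.
(* [N1] and [N2] write one numerator in two ways: adding the squared denominator (time coordinate)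
   or subtracting it (normal coordinate) leaves a single product. *)
have N1 : p ^+ 2 * (1 - h ^+ 2) + h ^+ 2 = 2 * p * (p - h * q) - (p - h * q) ^+ 2.
  transitivity (p ^+ 2 - h ^+ 2 * (p ^+ 2 - 1)); first ring.
  by rewrite [in X in _ * X]c2; ring.
have N2 : p ^+ 2 * (1 - h ^+ 2) + h ^+ 2 = 2 * h * q * (p - h * q) + (p - h * q) ^+ 2.
  transitivity (p ^+ 2 - h ^+ 2 * (p ^+ 2 - 1)); first ring.
  by rewrite [in X in _ * X]c2; ring.
apply: vec4P; rewrite /hlift /normal !mxE /= /enorm2 /sqmod /= /height /= ?E ?E1
  ?mulr0 ?addr0 ?mulr1.
- by rewrite N1; field; rewrite dn hn.
- by field; rewrite dn hn.
- by field; rewrite dn hn.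
- by rewrite N2; field; rewrite dn hn.
Qed.

Lemma ncoord_V x s : plane x -> ncoord (V x s) = sinhR s.
Proof.
move=> Px; rewrite /ncoord hlift_V // /normal !mxE eqxx mulr1.
by have /planeE[_] := Px; rewrite /ncoord /hlift mxE => ->; rewrite mulr0 add0r.
Qed.

(** The pairing of [y] with [V x s] is cosh^2 s - sinh^2 s = 1, so the two points coincide. *)
Lemma V_unique x y s : plane x -> H3 y -> ncoord y = sinhR s ->
  mform (hlift x) (hlift y) = coshR s -> y = V x s.
Proof.
move=> Px Hy yn xy; apply: mform_hlift1 => //; first exact: V_H3.
rewrite hlift_V // !mformE mform_normal (mformC (hlift y)) xy -/(ncoord y) yn.
by rewrite -(coshR_sinhR s); ring.
Qed.

(** A geodesic is only assumed to preserve distances. Let X be the lift of [c 0] and D the unit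
    tangent there, obtained from [c 1] by orthogonalization. The lift of [c t] minus cosh t X + sinh
    t D is null and orthogonal to X, hence zero; a and b are (X + D)/2 and (X - D)/2. *)
Lemma geodesic_hlift c : geodesic c -> exists a b,
  [/\ forall t, hlift (c t) = expR t *: a + expR (- t) *: b,
      mform a a = 0, mform b b = 0 & mform a b = 2^-1].
Proof.
move=> gc; have [Hc _] := gc.
set X := hlift (c 0); set Y := hlift (c 1).
have s1 : sinhR (1 : R) != 0 by rewrite gt_eqF // sinhR_gt0.
have XX : mform X X = 1 by rewrite mform_hliftxx.
have YY : mform Y Y = 1 by rewrite mform_hliftxx.
have XY : mform X Y = coshR 1 by rewrite mform_geodesic // sub0r coshRN.
have Xt t : mform X (hlift (c t)) = coshR t.
  by rewrite mform_geodesic // sub0r coshRN.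
have Yt t : mform Y (hlift (c t)) = coshR t * coshR 1 - sinhR t * sinhR 1.
  by rewrite mform_geodesic // coshRD coshRN sinhRN; ring.
pose D := (sinhR 1)^-1 *: (Y - coshR 1 *: X).
have XD : mform X D = 0 by rewrite /D !mformE XX XY; ring.
have DD : mform D D = -1.
  rewrite /D !mformE (mformC Y X) XX YY XY.
  apply: (mulIf (mulf_neq0 s1 s1)); rewrite -[RHS]mulrC mulrN1.
  rewrite [LHS](_ : _ = 1 - coshR 1 ^+ 2); last by field.
  by rewrite sqr_coshR; ring.
have tD t : mform (hlift (c t)) D = - sinhR t.
  by rewrite mformC /D !mformE Xt Yt; field.
have tt t : mform (hlift (c t)) (hlift (c t)) = 1 by rewrite mform_hliftxx.
clearbody D X; clear Y YY XY Yt.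
exists (2^-1 *: (X + D)), (2^-1 *: (X - D)).
have aa : mform (X + D) (X + D) = 0 by rewrite !mformE (mformC D X) XX XD DD; ring.
have bb : mform (X - D) (X - D) = 0 by rewrite !mformE (mformC D X) XX XD DD; ring.
have ab : mform (X + D) (X - D) = 2 by rewrite !mformE (mformC D X) XX XD DD; ring.
split=> [t|||]; rewrite ?mformZl ?mformZr ?aa ?bb ?ab ?mulr0 //; last by field.
have -> : expR t *: (2^-1 *: (X + D)) + expR (- t) *: (2^-1 *: (X - D)) =
    coshR t *: X + sinhR t *: D.
  by apply/rowP => i; rewrite !mxE /coshR /sinhR; ring.
apply/eqP; rewrite -subr_eq0 opprD addrA; apply/eqP.
apply: (@mform_definite _ X); rewrite ?XX // !mformE ?(mformC D)
  ?(mformC (hlift (c t)) X) Xt XX XD ?DD ?tt ?tD.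
  by ring.
have := sqr_coshR t; move: (coshR t) (sinhR t) => p q e.
rewrite le_eqVlt; apply/orP; left; apply/eqP.
transitivity (1 + q ^+ 2 - p ^+ 2); last by ring.
by rewrite e; ring.
Qed.

Lemma mform_geodesic_hlift c a b u : 
  (forall t, hlift (c t) = expR t *: a + expR (- t) *: b) ->
  forall t, mform u (hlift (c t)) = expR t * mform u a + expR (- t) * mform u b.
Proof. by move=> cE t; rewrite cE !mformE. Qed.

Lemma expR_comb_ge0 p q : (forall t, 0 <= expR t * p + expR (- t) * q) ->
  0 <= p /\ 0 <= q.
Proof.
have half p' q' : (forall t, 0 <= expR t * p' + expR (- t) * q') -> 0 <= p'.
  move=> H; rewrite leNgt; apply/negP => p0.
  (* With e^t = u, u times the combination is u^2 p' + q', at most u p' + |q'| = p' < 0. *)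
  pose u := 1 + `|q'| / - p'.
  have u1 : 1 <= u by rewrite lerDl divr_ge0 // oppr_ge0 ltW.
  have u0 : 0 < u by rewrite (lt_le_trans ltr01).
  have := H (ln u); rewrite expRN lnK ?posrE //.
  move=> /(mulr_ge0 (ltW u0)); rewrite mulrDr [u * (u^-1 * _)]mulrA divff ?gt_eqF //.
  rewrite mul1r leNgt => /negP; apply.
  have e : u * p' = p' - `|q'|.
    by rewrite /u mulrDl mul1r; congr (_ + _); field; rewrite lt_eqF.
  rewrite e; have := ler_norm q' => n.
  have : 0 <= `|q'| by [].
  by nra.
move=> H; split; first exact: half H.
by apply: (half q p) => t; have := H (- t); rewrite opprK addrC.
Qed.

(** The times 0 and ln 2 already give two independent linear equations. Applied to a coordinate of a
    geodesic, it says that a periodic coordinate vanishes. *)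
Lemma expR_comb_periodic p q l : 0 < l ->
  (forall t, expR (t + l) * p + expR (- (t + l)) * q =
     expR t * p + expR (- t) * q) -> p = 0 /\ q = 0.
Proof.
move=> l0 H; have := H 0; have := H (ln 2).
rewrite !(add0r, oppr0, opprD, expRD, expRN, expR0, invr1) !lnK ?posrE // !mul1r.
have : 1 < expR l by rewrite -expR0 ltr_expR.
move: (expR l) => E E1 h2 h1.
have E0 : 0 < E by lra.
have f1 : (E - 1) * (p - E^-1 * q) = 0.
  have -> : (E - 1) * (p - E^-1 * q) = (E * p + E^-1 * q) - (p + q).
    by field; rewrite gt_eqF.
  by rewrite h1 subrr.
have f2 : (E - 1) * (2 * p - E^-1 * q / 2) = 0.
  have -> : (E - 1) * (2 * p - E^-1 * q / 2) =
     (2 * E * p + (2 * E)^-1 * q) - (2 * p + 2^-1 * q) by field; rewrite gt_eqF.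
  by rewrite h2 subrr.
have En : E - 1 != 0 by rewrite gt_eqF // subr_gt0.
have {f1} f1 : p = E^-1 * q.
  by apply/eqP; rewrite -subr_eq0; move/eqP: f1; rewrite mulf_eq0 (negPf En).
have p0 : p = 0.
  by move/eqP: f2; rewrite mulf_eq0 (negPf En) -f1 /= => /eqP; lra.
split=> //; move/eqP: f1; rewrite p0 eq_sym mulf_eq0 invr_eq0 gt_eqF //.
by move/eqP.
Qed.

Lemma translated_plane c l : geodesic c -> 0 < l ->
  (forall t, ncoord (c (t + l)) = ncoord (c t)) -> forall t, plane (c t).
Proof.
move=> gc l0 H t; have [Hc _] := gc; apply/planeE; split=> //.
have [a [b [cE _ _ _]]] := geodesic_hlift gc.
have nE r : ncoord (c r) = expR r * a 0 i3 + expR (- r) * b 0 i3.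
  by rewrite /ncoord cE !mxE.
have [|a0 b0] := @expR_comb_periodic (a 0 i3) (b 0 i3) l l0.
  by move=> r; rewrite -!nE.
by rewrite nE a0 b0 !mulr0 addr0.
Qed.

Lemma plane_hconvex : hconvex (@plane R).
Proof.
move=> x y w /planeE[Hx x0] /planeE[Hy y0] Hw d; apply/planeE; split=> //.
have := collinear Hx Hy Hw (esym (coshR_hdist Hx Hw)) (esym (coshR_hdist Hw Hy)).
rewrite d => /(_ (esym (coshR_hdist Hx Hy))) E.
have := congr1 (fun v : 'rV[R]_4 => v 0 i3) E.
have scE (k : R) v : (k *: v) 0 i3 = k * v 0 i3 by rewrite mxE.
have adE u v : (u + v) 0 i3 = u 0 i3 + v 0 i3 by rewrite mxE.
have nE (z : point3 R) : hlift z 0 i3 = ncoord z by [].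
rewrite adE !scE !nE x0 y0 !mulr0 addr0.
(* If the coefficient of the lift of [w] vanishes, then x, y and w coincide. *)
move/eqP; rewrite mulf_eq0 => /orP[/eqP s0|/eqP//].
have d0 : hdist x y = 0 by apply: sinhR_inj; rewrite s0 sinhR0.
have xw0 : hdist x w = 0.
  by have := hdist_ge0 Hx Hw; have := hdist_ge0 Hw Hy; lra.
have := coshR_hdist Hx Hw; rewrite xw0 /coshR oppr0 expR0 => e.
by rewrite -(mform_hlift1 Hx Hw _) // -e; field.
Qed.

End Geodesics.

(** * Null directions, distance to a line, and ends *)

Section Ends.
Variable R : realType.
Implicit Types (x y w : point3 R) (c : R -> point3 R) (s t p q l e : R)
  (u v a b : 'rV[R]_4) (z : R[i]).

Local Notation i0 := (@Ordinal 4 0 isT).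
Local Notation i1 := (@Ordinal 4 1 isT).
Local Notation i2 := (@Ordinal 4 2 isT).
Local Notation i3 := (@Ordinal 4 3 isT).

Lemma laurent_eq0 (A B D : R) :
  (forall m, 0 < m -> A * m ^+ 2 + B + D * m ^- 2 = 0) -> A = 0 /\ D = 0.
Proof.
move=> H; have := H 1 ltr01; have := H 2 ltac:(by []); have := H 4 ltac:(by []).
have -> : (2 : R) ^- 2 = 1 / 4 by field.
have -> : (4 : R) ^- 2 = 1 / 16 by field.
rewrite !expr1n invr1; lra.
Qed.

(* Two geodesics translated along themselves by one isometry: their pairing is
   a Laurent polynomial in e^t and e^t', and its invariance forces the null
   directions of the two geodesics to agree. *)
Lemma translated_geodesic_unique c c' l l' : geodesic c -> geodesic c' ->
  0 < l -> 0 < l' ->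
  (forall t t', mform (hlift (c (t + l))) (hlift (c' (t' + l'))) =
     mform (hlift (c t)) (hlift (c' t'))) ->
  forall t', range c (c' t').
Proof.
move=> gc gc' l0 l'0 inv t'.
have [a [b [cE aa bb ab]]] := geodesic_hlift gc.
have [a' [b' [c'E aa' bb' ab']]] := geodesic_hlift gc'.
have [Hc _] := gc; have [Hc' _] := gc'.
have E1 : 1 < expR l by rewrite -expR0 ltr_expR.
have E1' : 1 < expR l' by rewrite -expR0 ltr_expR.
have pE t r : mform (hlift (c t)) (hlift (c' r)) =
    expR t * expR r * mform a a' + expR t * (expR r)^-1 * mform a b'
    + (expR t)^-1 * expR r * mform b a' + (expR t)^-1 * (expR r)^-1 * mform b b'.
  by rewrite cE c'E !mformE !expRN; ring.
have EE : 1 < expR l * expR l' by nra.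
(* On the diagonal e^t = e^t' = m the invariance is a Laurent polynomial identity in m, whose
   extreme coefficients contain <a, a'> and <b, b'>. *)
have [|A0 D0] := @laurent_eq0 ((expR l * expR l' - 1) * mform a a')
   ((expR l / expR l' - 1) * mform a b' + (expR l' / expR l - 1) * mform b a')
   (((expR l * expR l')^-1 - 1) * mform b b').
  move=> m m0; move/eqP: (inv (ln m) (ln m)); rewrite !pE !expRD lnK ?posrE //.
  rewrite -subr_eq0 => /eqP <-.
  by field; rewrite !gt_eqF // ?expR_gt0.
have aa'0 : mform a a' = 0.
  by apply/eqP; move/eqP: A0; rewrite mulf_eq0 (gt_eqF (_ : 0 < _ - 1)) ?subr_gt0.
have bb'0 : mform b b' = 0.
  apply/eqP; move/eqP: D0; rewrite mulf_eq0 (lt_eqF (_ : _ - 1 < 0)) //.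
  by rewrite subr_lt0 invf_lt1 // (lt_trans ltr01).
have a0 : a != 0.
  apply/eqP => a0; move: ab; rewrite a0 -(scale0r a) mformZl mul0r => /eqP.
  by rewrite eq_sym invr_eq0 pnatr_eq0.
have b0 : b != 0.
  apply/eqP => b0; move: ab; rewrite b0 -(scale0r b) mformZr mul0r => /eqP.
  by rewrite eq_sym invr_eq0 pnatr_eq0.
have [k aE] := mform_null aa aa' aa'0 a0.
have [m bE] := mform_null bb bb' bb'0 b0.
have km : k * m = 1.
  move: ab'; rewrite aE bE !mformE ab => e; apply: (mulIf (_ : 2^-1 != 0 :> R)).
    by rewrite invr_eq0 pnatr_eq0.
  by rewrite -mulrA e mul1r.
have k0 : 0 < k.
  have := mform_hlift_ge1 (Hc 0) (Hc' 0).
  rewrite cE c'E oppr0 expR0 !scale1r !mformE aE bE !mformE aa bb (mformC b a) ab.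
  rewrite !mulr0 add0r addr0 => h.
  rewrite ltNge; apply/negP => k0.
  have : m <= 0.
    by rewrite leNgt; apply/negP => m0; move: km; nra.
  move=> m0; have : (0 : R) < 2^-1 by []; move: (2^-1 : R) h => r h r0; nra.
have mE : m = k^-1.
  by apply: (mulfI (_ : k != 0)); rewrite ?km ?divff // gt_eqF.
(* Since a' = k a and b' = k^-1 b, the two parametrizations differ by the shift ln k. *)
exists (ln k + t') => //; apply: hlift_inj => //; rewrite cE c'E aE bE mE.
rewrite opprD !expRD (expRN (ln k)) lnK ?posrE // !scalerA.
by rewrite (mulrC k) (mulrC k^-1).
Qed.

(** The function cosh d(y, c t) equals e^t p + e^-t q with p, q > 0. Its minimum 2 sqrt(p q) is
    reached where e^(2t) = q / p, so the infimum in [set_dist] is attained. *)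
Lemma set_dist_geodesic c a b y : geodesic c -> H3 y ->
  (forall t, hlift (c t) = expR t *: a + expR (- t) *: b) ->
  mform a a = 0 -> mform b b = 0 -> mform a b = 2^-1 ->
  [/\ 0 <= set_dist y (range c),
     coshR (set_dist y (range c)) ^+ 2 =
       4 * (mform (hlift y) a * mform (hlift y) b)
   & 1 <= 4 * (mform (hlift y) a * mform (hlift y) b)].
Proof.
move=> gc Hy cE aa bb ab; have [Hc _] := gc.
have pE t := mform_geodesic_hlift (hlift y) cE t.
set p := mform (hlift y) a in pE *; set q := mform (hlift y) b in pE *.
have [p_ge0 q_ge0] : 0 <= p /\ 0 <= q.
  apply: expR_comb_ge0 => t; rewrite -pE.
  exact: le_trans ler01 (mform_hlift_ge1 Hy (Hc t)).
have half0 : (2^-1 : R) != 0 by rewrite invr_eq0 pnatr_eq0.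
have p0 : 0 < p.
  rewrite lt_neqAle p_ge0 andbT eq_sym; apply/eqP => p0.
  have a0 : a = 0 by apply: (@mform_definite _ (hlift y)); rewrite ?mform_hliftxx ?aa.
  by move/eqP: ab; rewrite a0 -(scale0r a) mformZl mul0r eq_sym (negPf half0).
have q0 : 0 < q.
  rewrite lt_neqAle q_ge0 andbT eq_sym; apply/eqP => q0.
  have b0 : b = 0 by apply: (@mform_definite _ (hlift y)); rewrite ?mform_hliftxx ?bb.
  by move/eqP: ab; rewrite b0 -(scale0r b) mformZr mul0r eq_sym (negPf half0).
pose t0 := (ln q - ln p) / 2.
have e2 : expR t0 * expR t0 = q / p.
  by rewrite -expRD /t0 -splitr expRD expRN !lnK ?posrE.
have e0 : 0 < expR t0 by rewrite expR_gt0.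
have sq : (expR t0 * p + expR (- t0) * q) ^+ 2 = 4 * (p * q).
  rewrite expRN; transitivity (expR t0 * expR t0 * p ^+ 2 + 2 * p * q +
    q ^+ 2 / (expR t0 * expR t0)); first by field; rewrite gt_eqF.
  by rewrite e2; field; rewrite !gt_eqF.
have min t : expR t0 * p + expR (- t0) * q <= expR t * p + expR (- t) * q.
  rewrite -ler_sqr ?nnegrE ?addr_ge0 ?mulr_ge0 ?expR_ge0 // sq -subr_ge0.
  have -> : (expR t * p + expR (- t) * q) ^+ 2 - 4 * (p * q) =
      (expR t * p - expR (- t) * q) ^+ 2.
    by rewrite expRN; field; rewrite gt_eqF ?expR_gt0.
  exact: sqr_ge0.
have -> : set_dist y (range c) = hdist y (c t0).
  apply/eqP; rewrite eq_le; apply/andP; split.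
    apply: ge_inf; last by exists (c t0) => //; exists t0.
    by exists 0 => _ [_ [t _ <-] <-]; apply: hdist_ge0.
  apply: lb_le_inf; first by exists (hdist y (c t0)), (c t0) => //; exists t0.
  move=> _ [_ [t _ <-] <-].
  by rewrite -ler_coshR ?hdist_ge0 // !coshR_hdist // !pE.
rewrite hdist_ge0 // coshR_hdist // pE sq; split=> //.
by rewrite -sq -pE exprn_ege1 // mform_hlift_ge1.
Qed.

Lemma expRN_lt q e t : 0 <= q -> 0 < e -> q / e <= t -> q * expR (- t) < e.
Proof.
move=> q0 e0 le; have t0 : 0 <= t by apply: le_trans le; rewrite divr_ge0 // ltW.
rewrite expRN ltr_pdivrMr ?expR_gt0 //.
have := expR_ge1Dx t; rewrite ler_pdivrMr // in le; nra.
Qed.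

(** The end is the ideal point of the null vector a, namely (a_1 + i a_2) / a_0. In the plane the
    height is the inverse of the time coordinate, so it decays like e^-t, and the squared Euclidean
    distance to the end is at most Q e^-t. *)
Lemma geodesic_end c : geodesic c -> (forall t, plane (c t)) ->
  exists z, ends_at c (Some z).
Proof.
move=> gc Pc; have [Hc _] := gc.
have [a [b [cE aa bb ab]]] := geodesic_hlift gc.
have X3 t : ncoord (c t) = 0 by have /planeE[] := Pc t.
have X0 t : (height (c t))^-1 = expR t * a 0 i0 + expR (- t) * b 0 i0.
  have -> : (height (c t))^-1 = hlift (c t) 0 i0 - hlift (c t) 0 i3.
    rewrite /hlift !mxE /=; field; rewrite gt_eqF //; exact: Hc.
  by rewrite -/(ncoord _) X3 subr0 cE !mxE.
have X1 t : (c t).1.1 / height (c t) = expR t * a 0 i1 + expR (- t) * b 0 i1.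
  by have := congr1 (fun v : 'rV[R]_4 => v 0 i1) (cE t); rewrite !mxE.
have X2 t : (c t).1.2 / height (c t) = expR t * a 0 i2 + expR (- t) * b 0 i2.
  by have := congr1 (fun v : 'rV[R]_4 => v 0 i2) (cE t); rewrite !mxE.
have a3 : a 0 i3 = 0.
  have [] // := @expR_comb_periodic _ (a 0 i3) (b 0 i3) 1 ltr01 => t.
  by have := X3 (t + 1); have := X3 t; rewrite /ncoord !cE !mxE => -> ->.
have [a0 b0] : 0 <= a 0 i0 /\ 0 <= b 0 i0.
  by apply: expR_comb_ge0 => t; rewrite -X0 invr_ge0 ltW //; exact: Hc.
have {a0} a0 : 0 < a 0 i0.
  rewrite lt_neqAle a0 andbT eq_sym; apply/eqP => a00.
  have ae : a = 0.
    have s1 := sqr_ge0 (a 0 i1); have s2 := sqr_ge0 (a 0 i2).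
    move: aa; rewrite /mform a00 a3 !mul0r sub0r => aa.
    apply: vec4P; rewrite ?mxE //;
      apply/eqP; rewrite -sqrf_eq0 eq_le sqr_ge0 andbT; lra.
  move/eqP: ab; rewrite ae -(scale0r a) mformZl mul0r eq_sym invr_eq0.
  by rewrite pnatr_eq0.
pose z := (a 0 i1 / a 0 i0 +i* (a 0 i2 / a 0 i0))%C.
exists z => e e0.
pose k1 := (b 0 i1 * a 0 i0 - a 0 i1 * b 0 i0) / a 0 i0.
pose k2 := (b 0 i2 * a 0 i0 - a 0 i2 * b 0 i0) / a 0 i0.
pose Q := k1 ^+ 2 + k2 ^+ 2 + (a 0 i0)^-1 ^+ 2.
have Q0 : 0 <= Q by rewrite !addr_ge0 ?sqr_ge0.
exists (Q / e ^+ 2) => t tQ /=.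
have t0 : 0 <= t by apply: le_trans tQ; rewrite divr_ge0 ?sqr_ge0 //.
apply: le_lt_trans (expRN_lt Q0 _ tQ); last by rewrite exprn_gt0.
have /andP[h0 h1] := plane_height (Pc t).
have hn : height (c t) != 0 by rewrite gt_eqF.
have u0 : 0 < expR (- t) by rewrite expR_gt0.
have u1 : expR (- t) <= 1 by rewrite -expR0 ler_expR oppr_le0.
have E1 : (c t).1.1 - a 0 i1 / a 0 i0 = expR (- t) * k1 * height (c t).
  apply: (mulIf (invr_neq0 hn)); rewrite mulfK // mulrBl X1 X0 /k1 expRN.
  by field; rewrite !gt_eqF // expR_gt0.
have E2 : (c t).1.2 - a 0 i2 / a 0 i0 = expR (- t) * k2 * height (c t).
  apply: (mulIf (invr_neq0 hn)); rewrite mulfK // mulrBl X2 X0 /k2 expRN.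
  by field; rewrite !gt_eqF // expR_gt0.
clearbody k1 k2.
have hu : height (c t) <= expR (- t) * (a 0 i0)^-1.
  rewrite expRN -invfM mulrC -[leLHS]invrK lef_pV2 ?posrE
    ?invr_gt0 ?mulr_gt0 ?expR_gt0 //.
  by rewrite X0 (mulrC (expR t)) lerDl mulr_ge0 ?expR_ge0.
rewrite /edist2 /sqmod /= E1 E2 subr0.
have h2 : height (c t) ^+ 2 <= 1 by rewrite expr_le1 // ltW.
have hu2 : height (c t) ^+ 2 <= expR (- t) ^+ 2 * (a 0 i0)^-1 ^+ 2.
  by rewrite -exprMn ler_sqr ?nnegrE ?mulr_ge0 ?invr_ge0 ?expR_ge0 // ltW.
have uu : expR (- t) ^+ 2 <= expR (- t).
  by rewrite expr2 ler_piMr // ltW.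
apply: (@le_trans _ _ (Q * expR (- t) ^+ 2)); last by rewrite ler_wpM2l.
rewrite !exprMn /Q [leRHS]mulrDl; apply: lerD; last by rewrite mulrC.
rewrite -mulrDl -mulrDr [leRHS]mulrC; apply: ler_piMr => //.
by rewrite mulr_ge0 ?addr_ge0 ?sqr_ge0.
Qed.

End Ends.

(** * Ideal limits of points with bounded normal coordinate *)

Section IdealPoints.
Variable R : realType.
Implicit Types (x y w : point3 R) (c : R -> point3 R) (s t p q l e : R)
  (u v a b : 'rV[R]_4) (z : R[i]).

Local Notation i3 := (@Ordinal 4 3 isT).

Lemma sqmod_ge0 z : 0 <= sqmod z.
Proof. by rewrite /sqmod addr_ge0 ?sqr_ge0. Qed.

(** Here |y|^2 - |z|^2 = |y - z|^2 + 2 <y - z, z>, and the last product is bounded by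
    Cauchy-Schwarz; 1 + |z|^2 replaces |z| to avoid a square root. *)
Lemma near_ideal_norm e z y : 0 < e -> near_ideal e (Some z) y ->
  `|enorm2 y - sqmod z| <= e ^+ 2 + 2 * e * (1 + sqmod z).
Proof.
move=> e0; have := sqmod_ge0 z; rewrite /near_ideal /edist2 /enorm2 /sqmod /=.
case: y => [[a b] h] /=; case: z => z1 z2 /=; rewrite /height /= subr0.
set N := z1 ^+ 2 + z2 ^+ 2 => N0 near.
set D := (a - z1) ^+ 2 + (b - z2) ^+ 2 + h ^+ 2 in near.
have D0 : 0 <= D by rewrite !addr_ge0 ?sqr_ge0.
pose P := (a - z1) * z1 + (b - z2) * z2.
have -> : a ^+ 2 + b ^+ 2 + h ^+ 2 - N = D + 2 * P by rewrite /D /N /P; ring.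
have P2 : P ^+ 2 <= (e * (1 + N)) ^+ 2.
  apply: (@le_trans _ _ (D * N)).
    rewrite -subr_ge0 (_ : _ - _ = ((a - z1) * z2 - (b - z2) * z1) ^+ 2 + h ^+ 2 * N).
      by apply: addr_ge0; [exact: sqr_ge0|apply: mulr_ge0; rewrite ?sqr_ge0].
    by rewrite /D /N /P; ring.
  rewrite exprMn; apply: ler_pM => //; first exact: ltW.
  by rewrite expr2; nra.
have {}P2 : `|P| <= e * (1 + N).
  have N1 : 0 <= 1 + N by rewrite addr_ge0.
  rewrite -ler_sqr ?nnegrE ?(mulr_ge0 _ N1) ?(ltW e0) //.
  by rewrite real_normK ?num_real.
apply: (le_trans (ler_normD _ _)); rewrite (ger0_norm D0) normrM.
rewrite (ger0_norm (_ : 0 <= 2)) //.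
by apply: lerD; [exact: ltW|rewrite -mulrA ler_pM2l].
Qed.

Lemma near_ideal_height e z y : near_ideal e (Some z) y -> height y ^+ 2 < e ^+ 2.
Proof.
rewrite /near_ideal /edist2 /= subr0; apply: le_lt_trans.
by rewrite lerDr sqmod_ge0.
Qed.

Lemma small_eq0 (x K : R) : (forall e, 0 < e -> e <= 1 -> `|x| <= e * K) -> x = 0.
Proof.
move=> H; apply/eqP; rewrite -normr_eq0; apply/negPn/negP => x0.
have {}x0 : 0 < `|x| by rewrite lt_neqAle eq_sym x0 /=.
have K0 : 0 < K by have := H 1 ltr01 (lexx _); rewrite mul1r; apply: lt_le_trans.
pose e := Num.min 1 (`|x| / (2 * K)).
have e0 : 0 < e by rewrite lt_min ltr01 divr_gt0 // mulr_gt0.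
have e1 : e <= 1 by rewrite ge_min lexx.
have := H e e0 e1; rewrite leNgt => /negP; apply.
apply: (@le_lt_trans _ _ (`|x| / (2 * K) * K)).
  by rewrite ler_pM2r // ge_min lexx orbT.
rewrite (_ : _ / _ * K = `|x| / 2); first by rewrite ltr_pdivrMr // ltr_pMr // ltr1n.
by field; rewrite gt_eqF.
Qed.

Lemma ncoordE y : H3 y -> enorm2 y - 1 = 2 * height y * ncoord y.
Proof. by move=> Hy; rewrite /ncoord /hlift mxE /=; field; rewrite gt_eqF. Qed.

(** Everything comes from |y|^2 - 1 = 2 k height(y). Near a finite ideal point the height tends to
    0, so |z| = 1. Near infinity, height(y) <= |y| makes the right side too small. An orbit of G
    keeps its normal coordinate k, so this locates the limit set. *)
Lemma limit_circle (k : R) (xi : option R[i]) :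
  (forall e, 0 < e -> exists y, [/\ H3 y, ncoord y = k & near_ideal e xi y]) ->
  exists2 z, xi = Some z & sqmod z = 1.
Proof.
move=> H; case: xi H => [z|] H.
  exists z => //; apply/eqP; rewrite -subr_eq0; apply/eqP.
  apply: (@small_eq0 _ (2 * `|k| + 1 + 2 * (1 + sqmod z))) => e e0 e1.
  have [y [Hy yk near]] := H e e0.
  have h0 : 0 < height y by [].
  have h1 : height y < e.
    rewrite -ltr_sqr ?nnegrE; [exact: near_ideal_height near|exact: ltW..].
  have n1 := near_ideal_norm e0 near; have n2 := ncoordE Hy.
  rewrite (_ : sqmod z - 1 = (enorm2 y - 1) - (enorm2 y - sqmod z)); last by ring.
  apply: (le_trans (ler_normB _ _)); rewrite n2 yk !normrM (gtr0_norm h0).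
  rewrite (ger0_norm (_ : 0 <= 2)) //.
  have k0 : 0 <= `|k| by [].
  have ee : e ^+ 2 <= e by rewrite expr2 ler_piMr // ltW.
  move: n1; set N := `|_ - _| => n1.
  have hk : height y * `|k| <= e * `|k| by rewrite ler_wpM2r // ltW.
  by move: (sqmod z) (`|k|) (height y) hk n1 => r kk h; nra.
(* With n = |y|^2, the bound (n - 1)^2 <= 4 k^2 n forces n <= 2 + 4 k^2. *)
exfalso; pose M : R := 3 + 4 * k ^+ 2.
have M0 : 0 < M by rewrite /M; have := sqr_ge0 k; lra.
have [y [Hy yk]] := H (Num.sqrt M)^-1 ltac:(by rewrite invr_gt0 sqrtr_gt0).
rewrite /near_ideal -exprVn invrK sqr_sqrtr ?(ltW M0) // => near.
have := ncoordE Hy; rewrite yk => n2.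
have hN : height y ^+ 2 <= enorm2 y by rewrite /enorm2 lerDr sqmod_ge0.
have : (enorm2 y - 1) ^+ 2 <= 4 * k ^+ 2 * enorm2 y.
  rewrite n2 !exprMn; have -> : (2 : R) ^+ 2 = 4 by ring.
  by rewrite mulrAC ler_wpM2l // mulr_ge0 ?sqr_ge0.
have := sqr_ge0 k.
by move: (enorm2 y) near; rewrite /M; move: (k ^+ 2) => r n; nra.
Qed.

(* With c(t) = e^t a + e^-t b, the height of c(t) is at least of order e^-t,
   and |c(t)|^2 - 1 tends to 0, which forces the normal coordinate of a to
   vanish. *)
Lemma end_on_circle c z a b : geodesic c -> ends_at c (Some z) -> sqmod z = 1 ->
  (forall t, hlift (c t) = expR t *: a + expR (- t) *: b) -> a 0 i3 = 0.
Proof.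
move=> gc ez z1 cE; have [Hc _] := gc.
pose i0 := @Ordinal 4 0 isT.
pose K := `|a 0 i0 - a 0 i3| + `|b 0 i0 - b 0 i3|.
have K0 : 0 <= K by rewrite addr_ge0.
apply: (@small_eq0 _ (5 * K + 1)) => e e0 e1.
have [T HT] := ez e e0.
pose t := Num.max (Num.max T 0) (`|b 0 i3| / e).
have [tT t0 te] : [/\ T <= t, 0 <= t & `|b 0 i3| / e <= t].
  by rewrite /t !le_max !lexx !orbT.
have near := HT t tT.
have n1 := near_ideal_norm e0 near; rewrite z1 in n1.
have b1 := expRN_lt (normr_ge0 (b 0 i3)) e0 te.
have n2 := ncoordE (Hc t).
have h0 : 0 < height (c t) by exact: Hc.
have u1 : 1 <= expR t by rewrite -expR0 ler_expR.
have v1 : expR (- t) <= 1 by rewrite -expR0 ler_expR oppr_le0.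
have v0 := expR_gt0 (- t).
have hK : (height (c t))^-1 <= K * expR t.
  have -> : (height (c t))^-1 = hlift (c t) 0 i0 - hlift (c t) 0 i3.
    by rewrite /hlift !mxE /=; field; rewrite gt_eqF.
  rewrite cE !mxE opprD addrACA -!mulrBr /K mulrDl; apply: lerD.
    by rewrite mulrC ler_wpM2r ?expR_ge0 // ler_norm.
  apply: (le_trans (ler_norm _)); rewrite normrM (gtr0_norm v0) mulrC.
  by rewrite ler_wpM2l // (le_trans v1).
have n3 : 2 * `|ncoord (c t)| <= 5 * e * K * expR t.
  have -> : 2 * `|ncoord (c t)| = `|enorm2 (c t) - 1| * (height (c t))^-1.
    rewrite n2 !normrM (gtr0_norm h0) (ger0_norm (_ : 0 <= 2)) //.
    by field; rewrite gt_eqF.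
  apply: (le_trans (ler_pM _ _ n1 hK)) => //; first by rewrite invr_ge0 ltW.
  rewrite -(mulrA (5 * e)); apply: ler_wpM2r; first by rewrite mulr_ge0 ?expR_ge0.
  by rewrite expr2; nra.
have nE : ncoord (c t) = expR t * a 0 i3 + expR (- t) * b 0 i3.
  by rewrite /ncoord cE !mxE.
have n4 : expR t * `|a 0 i3| <= `|ncoord (c t)| + e.
  rewrite -[X in X * _](gtr0_norm (expR_gt0 t)) -normrM.
  rewrite (_ : expR t * _ = ncoord (c t) - expR (- t) * b 0 i3); last by rewrite nE addrK.
  apply: (le_trans (ler_normB _ _)); rewrite lerD2l normrM (gtr0_norm v0) mulrC.
  exact: ltW.
have u0 : 0 < expR t by rewrite expR_gt0.
rewrite -(ler_pM2l u0); apply: (le_trans n4).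
have eu : e <= e * expR t by rewrite ler_peMr // ltW.
have : 0 <= e * K * expR t by rewrite !mulr_ge0 // ltW.
move: n3 eu; move: (`|ncoord _|) => N; rewrite -(mulrA 5 e K) -(mulrA 5).
rewrite (_ : expR t * _ = 5 * (e * K * expR t) + e * expR t); last by ring.
by move: (e * K * expR t) (e * expR t) => r1 r2; lra.
Qed.

Lemma geodesic_ends_plane c z z' : geodesic c -> ends_at c (Some z) ->
  ends_at (fun t => c (- t)) (Some z') -> sqmod z = 1 -> sqmod z' = 1 ->
  forall t, plane (c t).
Proof.
move=> gc ez ez' z1 z'1 t; have [Hc dc] := gc.
have [a [b [cE _ _ _]]] := geodesic_hlift gc.
have a3 := end_on_circle gc ez z1 cE.
have b3 : b 0 i3 = 0.
  apply: (end_on_circle _ ez' z'1) => [|r]; last by rewrite cE opprK addrC.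
  by split=> // r r'; rewrite dc opprK addrC distrC.
by apply/planeE; split=> //; rewrite /ncoord cE !mxE a3 b3 !mulr0 addr0.
Qed.

End IdealPoints.

(** * The action of SL(2,C) *)

Section Action.
Local Open Scope complex_scope.
Variable R : realType.
Local Notation C := R[i].
Local Notation mx := 'M[C]_2.
Implicit Types (M N : mx) (x y : point3 R) (z : C).

Lemma mul2E M N i j : (M * N) i j = M i 0 * N 0 j + M i 1 * N 1 j.
Proof.
rewrite -[M * N]/(M *m N) mxE !big_ord_recl big_ord0 addr0.
by congr (_ * _ + M i _ * N _ j); apply: val_inj.
Qed.

Lemma det2E M : \det M = M 0 0 * M 1 1 - M 0 1 * M 1 0.
Proof.
rewrite (expand_det_row _ 0) !big_ord_recl big_ord0 addr0.
have e1 : lift ord0 (ord0 : 'I_1) = 1 :> 'I_2 by apply: val_inj.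
have e3 : lift (1 : 'I_2) (0 : 'I_1) = 0 :> 'I_2 by apply: val_inj.
rewrite /cofactor !det_mx11 !mxE /= !e1 e3 /=.
by rewrite addn0 add0n expr0 expr1; ring.
Qed.

Lemma mx2P M N : M 0 0 = N 0 0 -> M 0 1 = N 0 1 -> M 1 0 = N 1 0 ->
  M 1 1 = N 1 1 -> M = N.
Proof.
move=> e0 e1 e2 e3; apply/matrixP => i j.
have h (k : 'I_2) : k = 0 \/ k = 1.
  by case: k => -[|[|//]] p; [left|right]; apply: val_inj.
by case: (h i) => ->; case: (h j) => ->.
Qed.

Lemma sqmodC z : (sqmod z)%:C = z * z^*.
Proof.
case: z => a b; rewrite /sqmod /=; apply/eqP; rewrite eq_complex /=.
by apply/andP; split; apply/eqP; ring.
Qed.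

Definition adj M : mx := \matrix_(i, j) (M j i)^*.

Lemma adjE M i j : adj M i j = (M j i)^*.
Proof. by rewrite mxE. Qed.

Lemma adjM M N : adj (M * N) = adj N * adj M.
Proof.
apply/matrixP => i j; rewrite !(mul2E, mxE) rmorphD !rmorphM /=.
by rewrite (mulrC (_ ^*)) [X in _ + X]mulrC.
Qed.

(* In the Hermitian model of H3 the Poincare extension of M becomes linear:
   H |-> M H M^*. *)
Definition hmat x : mx :=
  let t := (height x)%:C in let z := coz x in
  \matrix_(i, j) (t^-1 * (if i == 0 then if j == 0 then z * z^* + t ^+ 2 else z
                       else if j == 0 then z^* else 1)).

Lemma hmatE x (t := (height x)%:C) (z := coz x) :
  [/\ hmat x 0 0 = t^-1 * (z * z^* + t ^+ 2), hmat x 0 1 = t^-1 * z,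
      hmat x 1 0 = t^-1 * z^* & hmat x 1 1 = t^-1].
Proof. by rewrite /hmat; split; rewrite mxE /= ?mulr1. Qed.

Lemma hmat_hermitian x i j : (hmat x i j)^* = hmat x j i.
Proof.
have cV (r : R) : ((r%:C)^-1)^* = (r%:C)^-1 by rewrite conjc_inv conjc_real.
have cX (r : R) : (r%:C ^+ 2)^* = r%:C ^+ 2 
  by rewrite [LHS]rmorphXn; congr (_ ^+ 2); exact: conjc_real.
rewrite /hmat !mxE; set t := (_)%:C; rewrite [LHS]rmorphM; congr (_ * _).
  exact: cV.
case: (i == 0); case: (j == 0); cbv iota;
  [|by []|exact: conjcK|exact: conjc1].
rewrite [LHS]rmorphD [X in X + _]rmorphM; congr (_ + _); last exact: cX.
by rewrite [X in _ * X]conjcK mulrC.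
Qed.

Lemma height_neq0 x : H3 x -> (height x)%:C != 0.
Proof. by move=> Hx; rewrite fmorph_eq0 gt_eqF. Qed.

Lemma det_hmat x : H3 x -> \det (hmat x) = 1.
Proof.
move=> Hx; have t0 := height_neq0 Hx.
by rewrite det2E; have [-> -> -> ->] := hmatE x; field.
Qed.

Lemma hmat_inj x y : H3 x -> H3 y -> hmat x = hmat y -> x = y.
Proof.
move=> Hx Hy e; have t0 := height_neq0 Hx; have t'0 := height_neq0 Hy.
have [_ x01 _ x11] := hmatE x; have [_ y01 _ y11] := hmatE y.
have th : (height x)%:C = (height y)%:C.
  by apply: invr_inj; rewrite -x11 -y11 e.
have z : coz x = coz y.
  by apply: (mulfI (invr_neq0 t0)); rewrite -x01 th -y01 e.
case: x y {Hx Hy e t0 t'0 x01 x11 y01 y11} th z => [[a b] h] [[a' b'] h'].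
by move=> [->] [-> ->].
Qed.

Definition aden M x := sqmod (mob_den M (coz x)) + sqmod (M 1 0) * height x ^+ 2.

Lemma aden_gt0 M x : \det M = 1 -> H3 x -> 0 < aden M x.
Proof.
move=> dM Hx; rewrite /aden.
have p0 (z : C) : 0 <= sqmod z by rewrite /sqmod addr_ge0 ?sqr_ge0.
have p1 (z : C) : sqmod z = 0 -> z = 0.
  by move=> /(congr1 (real_complex R)); rewrite sqmodC => /eqP;
     rewrite mulf_eq0 conjc_eq0 orbb => /eqP.
have h0 : 0 < height x ^+ 2 by rewrite exprn_gt0.
have m0 : 0 <= sqmod (M 1 0) * height x ^+ 2 by rewrite mulr_ge0 // ltW.
rewrite lt_neqAle (addr_ge0 _ m0) // andbT eq_sym.
rewrite (paddr_eq0 _ m0) // mulf_eq0 (gt_eqF h0) orbF.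
apply/negP => /andP[/eqP/p1 e1 /eqP/p1 e2].
move: dM e1; rewrite det2E /mob_den e2 mul0r mulr0 add0r subr0 => d e1.
by move/eqP: d; rewrite e1 mulr0 eq_sym oner_eq0.
Qed.

Lemma act_H3 M x : \det M = 1 -> H3 x -> H3 (act M x).
Proof. by move=> dM Hx; rewrite /H3 /= divr_gt0 // aden_gt0. Qed.

Lemma coz_mkpoint z t : coz (mkpoint z t) = z.
Proof. by case: z. Qed.

(** Three entries are computed directly. Both sides have determinant 1 and the same nonzero entry at
    (1, 1), which determines the entry at (0, 0). *)
Lemma hmat_act M x : \det M = 1 -> H3 x -> hmat (act M x) = M * hmat x * adj M.
Proof.
move=> dM Hx; have t0 := height_neq0 Hx; have d0 := aden_gt0 dM Hx.
have Hy := act_H3 dM Hx; have ty0 := height_neq0 Hy.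
set y := act M x in Hy ty0 *.
have dN : \det (M * hmat x * adj M) = 1.
  rewrite -![_ * _]/(_ *m _) !det_mulmx det_hmat // dM !mul1r.
  rewrite det2E !mxE -!rmorphM -rmorphB /= mulrC [X in _ - X]mulrC.
  by rewrite (mulrC (M 1 1)) -det2E dM conjc1.
have dE : (aden M x)%:C = mob_den M (coz x) * (mob_den M (coz x))^* +
     M 1 0 * (M 1 0)^* * (height x)%:C ^+ 2.
  by rewrite /aden rmorphD rmorphM /= rmorphXn /= !sqmodC.
have yt : (height y)%:C = (height x)%:C / (aden M x)%:C.
  by rewrite /y /act /= rmorphM /= fmorphV.
have d0C : (aden M x)%:C != 0 by rewrite fmorph_eq0 gt_eqF.
have [y00 y01 y10 y11] := hmatE y; have [x00 x01 x10 x11] := hmatE x.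
have e11 : hmat y 1 1 = (M * hmat x * adj M) 1 1.
  rewrite y11 yt invf_div dE !mul2E x00 x01 x10 x11 !mxE /mob_den.
  by rewrite rmorphD rmorphM /=; field.
have e01 : hmat y 0 1 = (M * hmat x * adj M) 0 1.
  rewrite y01 yt invf_div /y /act coz_mkpoint -/(aden M x) !mul2E x00 x01 x10 x11.
  rewrite !mxE [(_^-1)%:C]fmorphV /= [(_ ^+ 2)%:C]rmorphXn /=.
  move: (aden M x)%:C d0C => d d0C.
  by rewrite /mob_den rmorphD rmorphM /=; field; rewrite t0.
have e10 : hmat y 1 0 = (M * hmat x * adj M) 1 0.
  rewrite -(hmat_hermitian y 0 1) e01 !mul2E !adjE !(rmorphD, rmorphM) /=.
  by rewrite !conjcK !hmat_hermitian; ring.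
apply: mx2P => //.
have n11 : hmat y 1 1 != 0 by rewrite y11 invr_neq0.
apply: (mulIf n11); rewrite [in RHS]e11.
move: (det_hmat Hy) dN; rewrite !(det2E (hmat _)) (det2E (_ * _ * _)) -e10 -e01.
by move=> /eqP; rewrite subr_eq => /eqP -> /eqP; rewrite subr_eq => /eqP ->.
Qed.

Lemma actM M N x : \det M = 1 -> \det N = 1 -> H3 x ->
  act (M * N) x = act M (act N x).
Proof.
move=> dM dN Hx; have dMN : \det (M * N) = 1 by rewrite det_mulmx dM dN mulr1.
apply: hmat_inj; rewrite ?(act_H3, hmat_act) //; try do 2?apply: act_H3 => //.
by rewrite adjM !mulrA.
Qed.

Lemma act1 x : H3 x -> act (1 : mx) x = x.
Proof.
move=> Hx; apply: hmat_inj => //; first exact: act_H3 (det1 _ _) Hx.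
rewrite hmat_act ?det1 // mul1r (_ : adj 1 = 1) ?mulr1 //.
by apply/matrixP => i j; rewrite !mxE eq_sym conjc_nat.
Qed.

Lemma act_opp M x : act (- M) x = act M x.
Proof.
rewrite /act /mob_den !mxE.
have sN z : sqmod (- z) = sqmod z by case: z => a b; rewrite /sqmod /= !sqrrN.
by rewrite !mulNr -!opprD !sN !rmorphN /= !(mulrN, mulNr) !opprK.
Qed.

Lemma act_pm M N x : eq_pm M N -> act M x = act N x.
Proof. by case=> ->; rewrite ?act_opp. Qed.

Lemma actK M x : \det M = 1 -> H3 x -> act M^-1 (act M x) = x.
Proof.
move=> dM Hx; rewrite -actM ?det1V // mulVr ?det1_unit //.
exact: act1.
Qed.

Lemma actVK M x : \det M = 1 -> H3 x -> act M (act M^-1 x) = x.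
Proof.
move=> dM Hx; rewrite -actM ?det1V // mulrV ?det1_unit //.
exact: act1.
Qed.

(** The determinant is the quadratic form on Hermitian matrices, and this is its polarization;
    invariance of the pairing then reduces to multiplicativity of the determinant. *)
Lemma mform_hmat x y : H3 x -> H3 y ->
  (2 * mform (hlift x) (hlift y))%:C = \det (hmat x + hmat y) - 2.
Proof.
move=> Hx Hy; have t0 := height_neq0 Hx; have t'0 := height_neq0 Hy.
have aE i j : (hmat x + hmat y) i j = hmat x i j + hmat y i j by rewrite mxE.
rewrite mform_hlift // det2E !aE.
have [-> -> -> ->] := hmatE x; have [-> -> -> ->] := hmatE y.
have eE : (edist2 x y)%:C = (coz x - coz y) * ((coz x)^* - (coz y)^*)
    + ((height x)%:C - (height y)%:C) ^+ 2.
  by rewrite /edist2 [LHS]rmorphD /= sqmodC rmorphB /= rmorphXn rmorphB.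
have -> : 2 * (1 + edist2 x y / (2 * height x * height y)) =
    2 + edist2 x y / height x / height y.
  by field; rewrite !gt_eqF.
rewrite [LHS]rmorphD /= !rmorphM /= !fmorphV eE rmorph_nat /=.
by field; rewrite t0 t'0.
Qed.

Lemma mform_act M x y : \det M = 1 -> H3 x -> H3 y ->
  mform (hlift (act M x)) (hlift (act M y)) = mform (hlift x) (hlift y).
Proof.
move=> dM Hx Hy; apply: (mulfI (_ : 2 != 0)); first by rewrite pnatr_eq0.
have [Hx' Hy'] := (act_H3 dM Hx, act_H3 dM Hy).
apply: complexI; rewrite !mform_hmat // !hmat_act // -mulrDl -mulrDr.
congr (_ - _); rewrite -![_ * _]/(_ *m _) !det_mulmx dM mul1r.
suff -> : \det (adj M) = 1 by rewrite mulr1.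
rewrite det2E !mxE -!rmorphM -rmorphB /= mulrC [X in _ - X]mulrC.
by rewrite (mulrC (M 1 1)) -det2E dM conjc1.
Qed.

Lemma hdist_act M x y : \det M = 1 -> H3 x -> H3 y ->
  hdist (act M x) (act M y) = hdist x y.
Proof.
move=> dM Hx Hy; have [Hx' Hy'] := (act_H3 dM Hx, act_H3 dM Hy).
by rewrite (hdistE Hx' Hy') (hdistE Hx Hy) mform_act.
Qed.

Lemma ncoord_hmat x : H3 x -> (2 * ncoord x)%:C = hmat x 0 0 - hmat x 1 1.
Proof.
move=> Hx; have t0 := height_neq0 Hx; have [-> _ _ ->] := hmatE x.
have -> : 2 * ncoord x = (sqmod (coz x) + height x ^+ 2 - 1) / height x.
  by rewrite /ncoord /hlift mxE /= -/(enorm2 x); field; rewrite gt_eqF.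
rewrite [LHS]rmorphM fmorphV rmorphB rmorphD rmorphXn rmorph1 /= sqmodC.
by field.
Qed.

(* For det M = 1 this is membership in SU(1,1): the entries of M^* J M = J with
   J = diag(1, -1). *)
Definition su11 M : Prop :=
  [/\ M 0 0 * (M 0 0)^* - M 1 0 * (M 1 0)^* = 1,
      M 1 1 * (M 1 1)^* - M 0 1 * (M 0 1)^* = 1 &
      M 1 0 * (M 1 1)^* = M 0 0 * (M 0 1)^*].

(** Twice the normal coordinate is the trace of J H with J = diag(1, -1), and M^* J M = J. *)
Lemma ncoord_act M x : \det M = 1 -> su11 M -> H3 x ->
  ncoord (act M x) = ncoord x.
Proof.
move=> dM [e0 e1 e2] Hx; apply: (mulfI (_ : 2 != 0)); first by rewrite pnatr_eq0.
have Hx' := act_H3 dM Hx.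
apply: complexI; rewrite !ncoord_hmat // hmat_act //.
rewrite !mul2E ![adj _ _ _]mxE.
have e2' : (M 1 0)^* * M 1 1 = (M 0 0)^* * M 0 1.
  by have := congr1 conjc e2; rewrite !rmorphM /= !conjcK.
transitivity (hmat x 0 0 * (M 0 0 * (M 0 0)^* - M 1 0 * (M 1 0)^*)
  + hmat x 0 1 * (M 0 0 * (M 0 1)^* - M 1 0 * (M 1 1)^*)
  + hmat x 1 0 * ((M 0 0)^* * M 0 1 - (M 1 0)^* * M 1 1)
  - hmat x 1 1 * (M 1 1 * (M 1 1)^* - M 0 1 * (M 0 1)^*)); first by ring.
by rewrite e0 e1 e2 e2'; ring.
Qed.

End Action.

(** * Discreteness *)

Section Discrete.
Local Open Scope complex_scope.
Variable R : realType.
Local Notation C := R[i].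
Local Notation mx := 'M[C]_2.
Implicit Types (M N g : mx) (G : set mx) (x y : point3 R) (z : C).

Lemma discP z : disc z <-> sqmod z < 1.
Proof.
rewrite /disc /= -(@expr_lt1 _ 2) // -add_Re2_Im2 -[(_ + _)]/(sqmod z).
by rewrite -(rmorph1 (real_complex R)) ltcR.
Qed.

Lemma sqmodM z z' : sqmod (z * z') = sqmod z * sqmod z'.
Proof. by case: z z' => [a b] [c d]; rewrite /sqmod /=; ring. Qed.

Lemma sqmod_eq0 z : (sqmod z == 0) = (z == 0).
Proof.
rewrite -[LHS](inj_eq (@complexI R)) /= sqmodC mulf_eq0 conjc_eq0 orbb.
by [].
Qed.

Lemma inv2E M : \det M = 1 -> [/\ M^-1 0 0 = M 1 1, M^-1 0 1 = - M 0 1,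
  M^-1 1 0 = - M 1 0 & M^-1 1 1 = M 0 0].
Proof.
move=> dM; pose N : mx := \matrix_(i, j)
  (if i == 0 then if j == 0 then M 1 1 else - M 0 1
   else if j == 0 then - M 1 0 else M 0 0).
have E : N * M = 1.
  by apply: mx2P; rewrite mul2E !mxE /= -?dM ?det2E; ring.
have -> : M^-1 = N.
  by rewrite -[RHS]mulr1 -(divrr (det1_unit dM)) mulrA E mul1r.
by split; rewrite mxE.
Qed.

Lemma quadratic_limit (a b c : R) :
  (forall r, 0 <= r -> r < 1 -> 0 < a * r ^+ 2 + b * r + c) -> 0 <= a + b + c.
Proof.
move=> H; rewrite leNgt; apply/negP => f1.
(* Going from 1 to 1 - h raises the value by at most h K, which is too little to make the negative
   value at 1 positive. *)
pose K := 2 * `|a| + `|b| + 1.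
have K1 : 1 <= K by rewrite lerDr addr_ge0 // mulr_ge0.
have K0 : 0 < K by apply: lt_le_trans K1.
pose h := Num.min 1 (- (a + b + c) / K).
have h0 : 0 < h by rewrite lt_min ltr01 divr_gt0 // oppr_gt0.
have h1 : h <= 1 by rewrite ge_min lexx.
have hK : h * K <= - (a + b + c) by rewrite -ler_pdivlMr // ge_min lexx orbT.
have := H (1 - h); rewrite subr_ge0 h1 ltrBlDr ltrDl h0 => /(_ isT isT).
have n1 := ler_norm a; have n2 := ler_norm (- a); have n3 := ler_norm (- b).
rewrite !normrN in n2 n3.
rewrite (_ : a * _ + _ + _ = (a + b + c) - h * (2 * a + b - a * h)); last by ring.
have : - (2 * a + b - a * h) <= K.
  rewrite /K; move: (`|a|) (`|b|) n1 n2 n3 => p q n1 n2 n3.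
  by nra.
move=> le; have : h * - (2 * a + b - a * h) <= h * K by rewrite ler_pM2l.
by rewrite mulrN; lra.
Qed.

Definition disc_form M z : R :=
  sqmod (M 1 0 * z + M 1 1) - sqmod (M 0 0 * z + M 0 1).

Lemma disc_formE M z (b := M 1 0 * (M 1 1)^* - M 0 0 * (M 0 1)^*) :
  disc_form M z = (sqmod (M 1 0) - sqmod (M 0 0)) * sqmod z
   + 2 * (complex.Re b * complex.Re z - complex.Im b * complex.Im z)
   + (sqmod (M 1 1) - sqmod (M 0 1)).
Proof.
rewrite /disc_form /b /sqmod; case: (M 0 0) (M 0 1) (M 1 0) (M 1 1) z.
by move=> ? ? [? ?] [? ?] [? ?] [? ?] /=; ring.
Qed.

Lemma mob_disc_form M z : mob_den M z != 0 -> disc (mob M z) <-> 0 < disc_form M z.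
Proof.
move=> d0; rewrite discP /mob /disc_form -/(mob_den M z) subr_gt0.
have d1 : 0 < sqmod (mob_den M z).
  by rewrite lt_neqAle eq_sym sqmod_eq0 d0 /sqmod addr_ge0 ?sqr_ge0.
set n := _ + _; set m := mob_den M z in d0 d1 *.
have -> : sqmod (n / m) = sqmod n / sqmod m.
  by apply: (mulIf (lt0r_neq0 d1)); rewrite -sqmodM !divfK // lt0r_neq0.
by rewrite ltr_pdivrMr // mul1r.
Qed.

(** On the unit circle [disc_form g] is nonnegative as a limit from inside. It is nonpositive as
    well: otherwise g z would lie in the disc and g^-1 would carry it back to the circle. Its zeros
    at 1, -1 and i give the relations between the entries, up to normalization. *)
Lemma invariant_su11 G g : psl_subgroup G -> invariant_disc G -> G g -> su11 g.
Proof.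
move=> sG iG Gg; have dg := psl_det sG Gg.
have pos M z : G M -> sqmod z < 1 -> 0 < disc_form M z.
  by move=> GM /discP Dz; have [d0 Dm] := iG M z GM Dz; apply/mob_disc_form.
have npos z : sqmod z = 1 -> disc_form g z <= 0.
  move=> z1; rewrite leNgt; apply/negP => f0.
  have d0 : mob_den g z != 0.
    rewrite -sqmod_eq0 gt_eqF //; move: f0; rewrite subr_gt0; apply: le_lt_trans.
    by rewrite /sqmod addr_ge0 ?sqr_ge0.
  have /discP w1 : disc (mob g z) by apply/mob_disc_form.
  have := pos _ _ (pslV sG Gg) w1; rewrite subr_gt0.
  have [-> -> -> ->] := inv2E dg.
  move: dg; rewrite det2E => dg.
  have -> : - g 1 0 * mob g z + g 0 0 = (mob_den g z)^-1.
    rewrite -[RHS]mul1r -dg /mob; rewrite /mob_den in d0 *; by field.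
  have -> : g 1 1 * mob g z + - g 0 1 = z * (mob_den g z)^-1.
    transitivity ((g 0 0 * g 1 1 - g 0 1 * g 1 0) * z * (mob_den g z)^-1);
      last by rewrite dg mul1r.
    by rewrite /mob; rewrite /mob_den in d0 *; field.
  by rewrite sqmodM z1 mul1r ltxx.
have nneg z : sqmod z = 1 -> 0 <= disc_form g z.
  move=> z1; rewrite disc_formE z1 mulr1; apply: quadratic_limit => r r0 r1.
  have rz : sqmod (r%:C * z) < 1.
    rewrite sqmodM z1 mulr1 /sqmod /= expr0n addr0 /=.
    by rewrite expr_lt1.
  have := pos _ _ Gg rz; rewrite disc_formE sqmodM z1 mulr1.
  have -> : sqmod r%:C = r ^+ 2 by rewrite /sqmod /= expr0n /= addr0.
  have -> : complex.Re (r%:C * z) = r * complex.Re z.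
    by case: (z) => ? ? /=; ring.
  have -> : complex.Im (r%:C * z) = r * complex.Im z by case: (z) => ? ? /=; ring.
  move=> h; apply: (lt_le_trans h); rewrite le_eqVlt; apply/orP; left.
  by apply/eqP; ring.
have zero z : sqmod z = 1 -> disc_form g z = 0.
  by move=> z1; apply/eqP; rewrite eq_le npos ?nneg.
have z1 : sqmod (1 : C) = 1 by rewrite /sqmod /=; ring.
have zN1 : sqmod (- 1 : C) = 1 by rewrite /sqmod /=; ring.
have zi : sqmod (0 +i* 1 : C) = 1 by rewrite /sqmod /=; ring.
have z0 : sqmod (0 : C) < 1 by rewrite /sqmod /= expr0n /= addr0.
have := pos _ _ Gg z0; have := zero _ z1; have := zero _ zN1; have := zero _ zi.
rewrite !disc_formE z1 zN1 zi; set b := _ * (_^*) - _; rewrite /= => e1 e2 e3 e4.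
(* Up to sign the left side is the determinant of g^* J g with J = diag(1, -1). Once b = 0 the two
   diagonal differences are equal with product 1, and positivity at z = 0 selects the value 1. *)
have dd : sqmod b - (sqmod (g 1 0) - sqmod (g 0 0)) * (sqmod (g 1 1) - sqmod (g 0 1)) = 1.
  rewrite -z1 -dg det2E /b /sqmod; case: (g 0 0) (g 0 1) (g 1 0) (g 1 1).
  by move=> ? ? [? ?] [? ?] [? ?] /=; ring.
have b0 : b = 0.
  apply/eqP; rewrite eq_complex; apply/andP; split; apply/eqP => /=; lra.
rewrite b0 {1}/sqmod /= in dd.
have e0 : sqmod (g 0 0) - sqmod (g 1 0) = sqmod (g 1 1) - sqmod (g 0 1) by lra.
have l1 : sqmod (g 1 1) - sqmod (g 0 1) = 1.
  move: e0 e4 dd; rewrite -[sqmod (g 1 0) - _]opprB => ->.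
  move: (sqmod (g 1 1) - _) => r; rewrite !expr0n /=; nra.
split; last by apply/eqP; rewrite -subr_eq0; apply/eqP.
  by rewrite -!sqmodC -rmorphB /= e0 l1.
by rewrite -!sqmodC -rmorphB /= l1.
Qed.

(** Each coordinate is rounded down to a cell of width e. There are finitely many tuples of cells,
    and one index more than tuples is considered. *)
Lemma pigeonhole (I : finType) (u : nat -> I -> R) (K e : R) :
  (forall n i, `|u n i| <= K) -> 0 < e ->
  exists m n, (m < n)%N /\ forall i, `|u n i - u m i| < e.
Proof.
move=> uK e0.
pose f n i := Num.truncn ((u n i + K) / e).
have pos n i : 0 <= (u n i + K) / e.
  rewrite divr_ge0 ?(ltW e0) //; have := uK n i; rewrite ler_norml => /andP[].
  by lra.
pose N := Num.truncn ((K + K) / e).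
have fN n i : (f n i < N.+1)%N.
  rewrite ltnS; apply: le_truncn; rewrite ler_pM2r ?invr_gt0 // lerD2r.
  by have := uK n i; rewrite ler_norml => /andP[].
pose F (n : 'I_(#|{: {ffun I -> 'I_N.+1}}|.+1)) : {ffun I -> 'I_N.+1} :=
  [ffun i => Ordinal (fN n i)].
have /injectivePn[m0 [n0 mn FE]] : ~~ injectiveb F.
  apply/negP => /injectiveP/leq_card; rewrite card_ord ltnn //.
wlog lt : m0 n0 mn FE / (m0 < n0)%N.
  move=> H; case: (ltngtP m0 n0) => [|lt|/val_inj mn0]; first exact: H mn FE.
    by apply: H lt; [rewrite eq_sym|].
  by rewrite mn0 eqxx in mn.
exists m0, n0; split=> // i.
have fE : f m0 i = f n0 i.
  by have := congr1 (fun h : {ffun I -> 'I_N.+1} => val (h i)) FE; rewrite !ffunE.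
have := truncn_itv (pos m0 i); have := truncn_itv (pos n0 i).
rewrite -/(f _ _) -/(f m0 i) fE => /andP[l1 l2] /andP[l3 l4].
rewrite ler_pdivlMr // in l1; rewrite ler_pdivlMr // in l3.
rewrite ltr_pdivrMr // -natr1 in l2; rewrite ltr_pdivrMr // -natr1 in l4.
by rewrite ltr_norml; move: ((f n0 i)%:R) l1 l2 l3 l4 => k; nra.
Qed.

(** The stabilizer of a point is bounded: the diagonal entries of M H M^* = H say that each row (v,
    w) of M satisfies |v z + w|^2 + t^2 |v|^2 = H i, where y = (z, t). *)
Lemma fixing_bounded y : H3 y -> exists K : R, 1 <= K /\ forall M, \det M = 1 ->
  act M y = y -> forall i j,
    `|complex.Re (M i j)| <= K /\ `|complex.Im (M i j)| <= K.
Proof.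
move=> Hy; set t := height y; set z := coz y.
have t0 : 0 < t by [].
pose H (i : 'I_2) := if i == 0 then sqmod z + t ^+ 2 else 1.
have H0 i : 0 <= H i.
  by rewrite /H; case: ifP => // _; rewrite /sqmod !addr_ge0 ?sqr_ge0.
(* [K0] bounds |v|^2, and [K1] bounds |w|^2 through |w|^2 <= 2 |v z + w|^2 + 2 |v z|^2. *)
pose K0 := (H 0 + H 1) / t ^+ 2.
pose K1 := 2 * (H 0 + H 1) + 2 * (K0 * sqmod z).
have sz : 0 <= sqmod z by rewrite /sqmod addr_ge0 ?sqr_ge0.
have K00 : 0 <= K0 by rewrite divr_ge0 ?addr_ge0 ?sqr_ge0.
have K10 : 0 <= K1.
  by apply: addr_ge0; apply: mulr_ge0 => //; [exact: addr_ge0|exact: mulr_ge0].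
exists (1 + K0 + K1); split; first by rewrite -addrA lerDl addr_ge0.
move=> M dM fix_y i.
have := hmat_act dM Hy; rewrite fix_y => /(congr1 (fun h : mx => h i i)).
rewrite !mul2E !adjE; have [-> -> -> ->] := hmatE y; rewrite -/t -/z.
have -> : hmat y i i = (H i / t)%:C.
  rewrite /hmat mxE -/t -/z /H rmorphM /= fmorphV mulrC.
  by case: (i == 0); rewrite ?rmorph1 // rmorphD rmorphXn /= sqmodC.
set v := M i 0; set w := M i 1 => E.
have {}E : sqmod (v * z + w) + t ^+ 2 * sqmod v = H i.
  apply: complexI; rewrite rmorphD rmorphM rmorphXn /= !sqmodC !(rmorphD, rmorphM) /=.
  have tC : t%:C != 0 by rewrite fmorph_eq0 gt_eqF.
  apply: (mulIf (invr_neq0 tC)); move: E; rewrite rmorphM /= fmorphV => ->.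
  by ring.
have HH : H i <= H 0 + H 1.
  by rewrite /H; case: (i == 0); rewrite ?lerDl ?lerDr ?(H0 0) ?(H0 1) //; exact: (H0 0).
have p0 u : 0 <= sqmod u :> R by rewrite /sqmod addr_ge0 ?sqr_ge0.
have vK : sqmod v <= K0.
  rewrite /K0 ler_pdivlMr ?exprn_gt0 // mulrC; apply: le_trans HH.
  by rewrite -E lerDr.
have wK : sqmod w <= K1.
  have : sqmod w <= 2 * sqmod (v * z + w) + 2 * sqmod (v * z).
    move: (v * z) => q; rewrite -subr_ge0.
    rewrite (_ : _ - _ = sqmod (q + (q + w))); first exact: p0.
    by case: q (w) => ? ? [? ?]; rewrite /sqmod /=; ring.
  move=> h; apply: le_trans h _; rewrite /K1 sqmodM; apply: lerD.
    rewrite ler_pM2l //; apply: le_trans HH; rewrite -E lerDl.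
    by rewrite mulr_ge0 ?sqr_ge0.
  by rewrite ler_pM2l // ler_wpM2r.
have fin u : sqmod u <= K0 + K1 ->
    `|complex.Re u| <= 1 + K0 + K1 /\ `|complex.Im u| <= 1 + K0 + K1.
  rewrite /sqmod => su.
  have aux (r : R) : r ^+ 2 <= K0 + K1 -> `|r| <= 1 + K0 + K1.
    rewrite -[r ^+ 2]real_normK ?num_real //.
    by move: (`|r|) (normr_ge0 r) => q q0; nra.
  split; apply: aux; apply: le_trans su; rewrite ?lerDl ?lerDr ?sqr_ge0 //.
move=> j; apply: fin.
have [->|->] : j = 0 \/ j = 1.
  by case: j => -[|[|//]] p; [left|right]; apply: val_inj.
  by apply: le_trans vK _; rewrite lerDl.
by apply: le_trans wK _; rewrite lerDr.
Qed.

Lemma norm_le_ReIm z (r : R) : `|complex.Re z| <= r -> `|complex.Im z| <= r ->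
  `|z| <= (2 * r)%:C.
Proof.
move=> h1 h2; rewrite normc_def lecR.
have r0 : 0 <= r by apply: le_trans h1.
rewrite -[leRHS](ger0_norm (_ : 0 <= 2 * r)) ?mulr_ge0 // -sqrtr_sqr ler_wsqrtr //.
rewrite -[_ ^+ 2 in leLHS]real_normK ?num_real //.
rewrite -[complex.Im z ^+ 2]real_normK ?num_real //.
by move: (`|_|) (`|_|) (normr_ge0 (complex.Re z)) (normr_ge0 (complex.Im z))
  h1 h2 => p q; nra.
Qed.

(** The powers of g stay in a bounded set, so two of them are close; multiplying by the bounded
    inverse of one brings a power of g close to 1, where discreteness applies. *)
Lemma fixing_torsion G g y : psl_subgroup G -> discrete_subgroup G -> G g ->
  H3 y -> act g y = y -> exists n, g ^+ n.+1 = 1.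
Proof.
move=> sG [e e0 dG] Gg Hy gy.
have [K [K1 HK]] := fixing_bounded Hy.
have K0 : 0 < K by apply: lt_le_trans K1.
have GX n : G (g ^+ n) by exact: pslX.
have dX n : \det (g ^+ n) = 1 by apply: (psl_det sG).
have fX n : act (g ^+ n) y = y.
  elim: n => [|n IH]; first by rewrite expr0 act1.
  by rewrite exprS actM ?IH // (psl_det sG Gg).
have fXV n : act (g ^+ n)^-1 y = y by rewrite -{1}(fX n) actK.
pose u n (k : 'I_2 * 'I_2 * bool) :=
  if k.2 then complex.Re ((g ^+ n) k.1.1 k.1.2) else complex.Im ((g ^+ n) k.1.1 k.1.2).
have eE : e = (complex.Re e)%:C.
  by move: e0; rewrite ltcE /=; case: (e) => a b /= /andP[/eqP -> _].
have er0 : 0 < complex.Re e by move: e0; rewrite ltcE => /andP[].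
(* An entry of the product is a sum of two terms, each at most 2 K times 2 e / (16 K); the total is
   e / 2. *)
have [||m [n [mn uE]]] := @pigeonhole _ u K (complex.Re e / (16 * K)).
- move=> n [[i j] b]; rewrite /u /=; have [h1 h2] := HK _ (dX n) (fX n) i j.
  by case: b.
- by rewrite divr_gt0 // mulr_gt0.
exists (n - m).-1; rewrite prednK ?subn_gt0 //; apply: dG => // i j.
have -> : g ^+ (n - m) = (g ^+ m)^-1 * g ^+ n.
  by rewrite -[in RHS](subnKC (ltnW mn)) exprD mulKr // (psl_unit sG).
rewrite -[1 in X in _ - X](mulVr (psl_unit sG (GX m))).
have aE (M N : mx) : (M i j - N i j) = (M - N) i j by rewrite !mxE.
rewrite aE -mulrBr mul2E.
have Dle k : `|(g ^+ n - g ^+ m) k j| <= (2 * (complex.Re e / (16 * K)))%:C.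
  rewrite !mxE; apply: norm_le_ReIm.
    by have := uE (k, j, true); rewrite /u /= -raddfB => /ltW.
  by have := uE (k, j, false); rewrite /u /= -raddfB => /ltW.
have Ple k : `|(g ^+ m)^-1 i k| <= (2 * K)%:C.
  by have [h1 h2] := HK _ (det1V (dX m)) (fXV m) i k; apply: norm_le_ReIm.
apply: (le_lt_trans (ler_normD _ _)); rewrite !normrM.
apply: (@le_lt_trans _ _ ((2 * K)%:C * (2 * (complex.Re e / (16 * K)))%:C +
   (2 * K)%:C * (2 * (complex.Re e / (16 * K)))%:C)).
  by apply: lerD; apply: ler_pM.
rewrite -rmorphM -rmorphD /= eE ltcR /=.
rewrite (_ : _ + _ = complex.Re e / 2); first by rewrite ltr_pdivrMr // ltr_pMr // ltr1n.
by field; rewrite gt_eqF.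
Qed.

Lemma fixing_trivial G A B g y : psl_subgroup G -> discrete_subgroup G ->
  generators G A B -> freely A B -> G g -> H3 y -> act g y = y -> eq_pm g 1.
Proof.
move=> sG dG [GA GB gw] fAB Gg Hy gy.
have [n gn] := fixing_torsion sG dG Gg Hy gy.
have [uA uB] : A \is a GRing.unit /\ B \is a GRing.unit.
  by split; apply: (psl_unit sG).
have [w e] := gw _ Gg.
have e' : eq_pm g (word A B (reduce w)) by rewrite word_reduce.
have w0 : reduce w = [::].
  apply: (freely_torsion (n := n) uA uB fAB (reduced_reduce w)).
  by rewrite -gn; apply/eq_pmX/eq_pm_sym.
by rewrite w0 word_nil in e'.
Qed.

End Discrete.

(** * Axes and the convex core *)

Section Core.
Variable R : realType.
Local Notation C := R[i].
Local Notation mx := 'M[C]_2.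
Implicit Types (x y : point3 R) (c : R -> point3 R) (T g h k : mx).

Lemma geodesic_shift c t0 : geodesic c -> geodesic (fun t => c (t + t0)).
Proof. by case=> Hc dc; split=> // s t; rewrite dc opprD addrACA subrr addr0. Qed.

Lemma geodesic_rev c : geodesic c -> geodesic (fun t => c (- t)).
Proof. by case=> Hc dc; split=> // s t; rewrite dc opprK addrC distrC. Qed.

Lemma geodesic_act g c : \det g = 1 -> geodesic c -> geodesic (fun t => act g (c t)).
Proof.
move=> dg [Hc dc]; split=> [t|s t]; first exact: act_H3.
by rewrite hdist_act.
Qed.

Lemma plane_H3 x : plane x -> H3 x. Proof. by case. Qed.

Variable G : set mx.
Hypotheses (sG : psl_subgroup G) (iG : invariant_disc G).

Lemma ncoord_actG g x : G g -> H3 x -> ncoord (act g x) = ncoord x.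
Proof.
move=> Gg; apply: ncoord_act; first exact: (psl_det sG).
exact: invariant_su11 sG iG Gg.
Qed.

Lemma act_H3G g x : G g -> H3 x -> H3 (act g x).
Proof. by move=> /(psl_det sG); exact: act_H3. Qed.

Lemma plane_actG g x : G g -> plane x -> plane (act g x).
Proof.
move=> Gg /planeE[Hx x0]; apply/planeE; split; first exact: act_H3G.
by rewrite ncoord_actG.
Qed.

Lemma act_V g x s : G g -> plane x -> act g (V x s) = V (act g x) s.
Proof.
move=> Gg Px; have HV := V_H3 s Px; apply: V_unique.
- exact: plane_actG.
- exact: act_H3G.
- by rewrite ncoord_actG // ncoord_V.
- rewrite mform_act ?(psl_det sG Gg) //; last exact: plane_H3.
  rewrite hlift_V // !mformE mform_hliftxx ?mform_normal; last exact: plane_H3.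
  by have /planeE[_] := Px; rewrite /ncoord => ->; ring.
Qed.

Lemma to_quotient_act g y : G g -> H3 y ->
  to_quotient G (act g y) = to_quotient G y.
Proof.
move=> Gg Hy; apply/seteqP; split=> _ [k Gk <-].
  exists (k * g); first exact: pslM.
  by rewrite actM // ?(psl_det sG).
exists (k * g^-1); first by apply: pslM => //; exact: pslV.
have dg := psl_det sG Gg.
by rewrite actM ?(psl_det sG Gk) ?det1V ?actK //; exact: act_H3.
Qed.

Section Axis.
Variables (T : mx) (c : R -> point3 R) (l : R).
Hypotheses (GT : G T) (gc : geodesic c) (l0 : 0 < l)
  (Tc : forall t, act T (c t) = c (t + l)).

Lemma axis_plane t : plane (c t).
Proof.
apply: (translated_plane gc l0) => r; rewrite -Tc ncoord_actG //.
by case: gc.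
Qed.

Lemma act_exp n t : act (T ^+ n) (c t) = c (t + n%:R * l).
Proof.
have [Hc _] := gc; have dT := psl_det sG GT.
elim: n => [|n IH]; first by rewrite expr0 act1 // mul0r addr0.
rewrite exprS actM ?IH //; last exact: (psl_det sG (pslX sG n GT)).
by rewrite Tc -natr1 mulrDl mul1r addrA.
Qed.

Lemma axis_end_limit z : ends_at c (Some z) -> limit_set G (Some z).
Proof.
move=> ez; exists (c 0); first by case: gc.
move=> e e0; have [t0 ht0] := ez e e0.
pose n := Num.bound (t0 / l).
exists (T ^+ n); first exact: pslX.
rewrite act_exp add0r; apply: ht0.
have [t0n|t0p] := ltP t0 0; first by rewrite (le_trans (ltW t0n)) // mulr_ge0 // ltW.
by rewrite -ler_pdivrMr // ltW // archi_boundP // divr_ge0 // ltW.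
Qed.

End Axis.

Lemma axis_rev T c l : G T -> geodesic c -> 
  (forall t, act T (c t) = c (t + l)) ->
  forall t, act T^-1 (c (- t)) = c (- (t + l)).
Proof.
move=> GT [Hc _] Tc t; have := Tc (- (t + l)).
by rewrite opprD subrK -opprD => <-; rewrite actK // (psl_det sG).
Qed.

(** The positive powers of T carry a point of the axis to one end and those of T^-1 to the other.
    Both ends are limit points, so each convex set defining the hull contains the axis. *)
Lemma axis_core T : G T -> axis T `<=` convex_core G.
Proof.
move=> GT x [c [gc [[l l0 Tc] cx]]] K KH KC Kc.
have Pc := axis_plane GT gc l0 Tc.
have [z ez] := geodesic_end gc Pc.
have [z' ez'] := geodesic_end (geodesic_rev gc) (fun t => Pc (- t)).
apply: (Kc c (Some z) (Some z') gc _ _ ez ez') => //.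
  exact: axis_end_limit gc l0 Tc _ ez.
apply: axis_end_limit ez'; first exact: (pslV sG GT).
- exact: geodesic_rev.
- exact: l0.
- exact: axis_rev.
Qed.

Lemma limit_set_circle xi : limit_set G xi ->
  exists2 z, xi = Some z & sqmod z = 1.
Proof.
move=> [x Hx H]; apply: (@limit_circle _ (ncoord x)) => e /H[g Gg near].
by exists (act g x); split=> //; [exact: act_H3G|exact: ncoord_actG].
Qed.

(** The plane is one of the sets whose intersection is the hull: it is convex, and a geodesic with
    both ends on the unit circle lies in it. *)
Lemma core_plane : convex_core G `<=` @plane R.
Proof.
move=> x; apply; [by move=> y []|exact: plane_hconvex|].
move=> c xi eta gc /limit_set_circle[z -> z1] /limit_set_circle[z' -> z'1] ez ez'.
by move=> _ [t _ <-]; exact: geodesic_ends_plane ez ez' z1 z'1 t.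
Qed.

Lemma axis_act g T x : G g -> G T -> axis T x -> axis (g * T * g^-1) (act g x).
Proof.
move=> Gg GT [c [gc [[l l0 Tc] [t0 _ <-]]]]; have [Hc _] := gc.
have dg := psl_det sG Gg; have dT := psl_det sG GT.
exists (fun t => act g (c t)); split; first exact: geodesic_act.
split; last by exists t0.
exists l => // t; have Hgc := act_H3 dg (Hc t).
rewrite !actM ?det1V ?det_mulmx ?dg ?dT ?mulr1 //; last exact: act_H3 (det1V dg) Hgc.
by rewrite actK // Tc.
Qed.

(* The half-turn k exchanges p and T^-1 p, hence fixes their midpoint. *)
Lemma half_turn_axis T h k p q : G T -> eq_pm T (h * k) ->
  \det h = 1 -> act h p = p -> plane q -> half_turn (range (V q)) k ->
  axis T p -> axis T q.
Proof.
move=> GT TE dh hp Pq [dk k2 kfix] [c [gc [[l l0 Tc] [t0 _ ct0]]]].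
have [Hc _] := gc; have Hp : H3 p by rewrite -ct0.
have kE : act k^-1 p = act k p.
  by apply: act_pm; apply: involution_inv => //; exact: det1_unit.
have kp : act k p = c (t0 - l).
  rewrite -kE; have <- : act T^-1 p = c (t0 - l).
    by rewrite -ct0 -[in LHS](subrK l t0) -Tc actK // (psl_det sG).
  rewrite (act_pm p (eq_pmV TE)) invrM ?det1_unit // actM ?det1V //.
  by rewrite -{2}hp actK.
have kp' : act k (c (t0 - l)) = p.
  by rewrite -kp -actM // (act_pm p k2) act1.
have m1 : mform (hlift p) (hlift (c (t0 - l / 2))) = coshR (l / 2).
  by rewrite -ct0 mform_geodesic // opprB addrCA subrr addr0.
have m2 : mform (hlift (c (t0 - l / 2))) (hlift (c (t0 - l))) = coshR (l / 2).
  by rewrite mform_geodesic //; congr coshR; field.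
have m3 : mform (hlift p) (hlift (c (t0 - l))) = coshR (l / 2 + l / 2).
  by rewrite -ct0 mform_geodesic //; congr coshR; field.
set m := c (t0 - l / 2) in m1 m2 *.
have Hm : H3 m by exact: Hc.
have Hp' := Hc (t0 - l).
have Hkm := act_H3 dk Hm.
have km1 : mform (hlift p) (hlift (act k m)) = coshR (l / 2).
  by rewrite -kp' mform_act // mformC.
have km2 : mform (hlift (act k m)) (hlift (c (t0 - l))) = coshR (l / 2).
  by rewrite -kp mform_act // mformC.
have e1 := collinear Hp (Hc (t0 - l)) (Hc _) m1 m2 m3.
have e2 := collinear Hp (Hc (t0 - l)) Hkm km1 km2 m3.
have km : act k m = m.
  apply: hlift_inj => //; apply: (@scalerI _ _ (sinhR (l / 2 + l / 2))).
    by rewrite gt_eqF // sinhR_gt0 // -splitr.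
  by rewrite e1 e2.
have : [set x | H3 x /\ act k x = x] m by split.
rewrite kfix => -[u _ mE]; exists c; split=> //; split; first by exists l.
(* The fixed midpoint lies on the line [V q] and, being on the axis, in the plane; therefore it is
   q. *)
have := ncoord_V u Pq; rewrite mE.
have /planeE[_ ->] := axis_plane GT gc l0 Tc (t0 - l / 2).
rewrite -sinhR0 => /sinhR_inj u0; rewrite -u0 V0 in mE.
by exists (t0 - l / 2).
Qed.

Lemma axis_geodesic T c l : G T -> geodesic c -> 0 < l ->
  (forall t, act T (c t) = c (t + l)) -> axis T = range c.
Proof.
move=> GT gc l0 Tc; apply/seteqP; split=> [x|x [t0 _ ct0]]; last first.
  by exists c; split=> //; split; [exists l|exists t0].
move=> [c' [gc' [[l' l'0 Tc'] [t0 _ <-]]]].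
apply: (translated_geodesic_unique gc gc' l0 l'0) => t t'.
have [Hc _] := gc; have [Hc' _] := gc'.
by rewrite -Tc -Tc' mform_act // (psl_det sG).
Qed.

End Core.

(** * The strips *)

Section Strip.
Variable R : realType.
Implicit Types (x y : point3 R) (c m : R -> point3 R) (u v s t : R) (W : 'M[R[i]]_2).

Local Notation i0 := (@Ordinal 4 0 isT).
Local Notation i1 := (@Ordinal 4 1 isT).
Local Notation i2 := (@Ordinal 4 2 isT).
Local Notation i3 := (@Ordinal 4 3 isT).

Lemma continuous_expR_comb (p q : R) :
  continuous (fun t : R => expR t * p + expR (- t) * q).
Proof.
move=> t; apply: cvgD; apply: cvgMl.
  exact: continuous_expR.
by apply: (continuous_comp (f := fun t : R => - t));
  [exact: opp_continuous|exact: continuous_expR].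
Qed.

(** A geodesic preserves [hdist], whereas connectedness refers to the product topology; continuity
    is read off the exponential formula for the lift. *)
Lemma geodesic_continuous m : geodesic m ->
  [/\ continuous (fun t => (m t).1.1), continuous (fun t => (m t).1.2) &
      continuous (fun t => height (m t))].
Proof.
move=> gm; have [Hm _] := gm; have [a [b [mE _ _ _]]] := geodesic_hlift gm.
have X0 t : (height (m t))^-1 =
    expR t * (a 0 i0 - a 0 i3) + expR (- t) * (b 0 i0 - b 0 i3).
  have -> : (height (m t))^-1 = hlift (m t) 0 i0 - hlift (m t) 0 i3.
    by rewrite /hlift !mxE /=; field; rewrite gt_eqF //; exact: Hm.
  by rewrite mE !mxE; ring.
have ch : continuous (fun t => height (m t)).
  rewrite (_ : (fun t => _) = fun t => (expR t * (a 0 i0 - a 0 i3)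
      + expR (- t) * (b 0 i0 - b 0 i3))^-1); last first.
    by apply/funext => t; rewrite -X0 invrK.
  move=> t; apply: cvgV; last exact: continuous_expR_comb.
  by rewrite -X0 invr_neq0 // gt_eqF //; exact: Hm.
have X1 t : (m t).1.1 = height (m t) * (expR t * a 0 i1 + expR (- t) * b 0 i1).
  have := congr1 (fun v : 'rV[R]_4 => v 0 i1) (mE t); rewrite !mxE => <- /=.
  by field; rewrite gt_eqF //; exact: Hm.
have X2 t : (m t).1.2 = height (m t) * (expR t * a 0 i2 + expR (- t) * b 0 i2).
  have := congr1 (fun v : 'rV[R]_4 => v 0 i2) (mE t); rewrite !mxE => <- /=.
  by field; rewrite gt_eqF //; exact: Hm.
split=> //.
  rewrite (funext X1 : (fun t => (m t).1.1) = _) => t.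
  by apply: cvgM; [exact: ch|exact: continuous_expR_comb].
rewrite (funext X2 : (fun t => (m t).1.2) = _) => t.
by apply: cvgM; [exact: ch|exact: continuous_expR_comb].
Qed.

Lemma continuous_coshR : continuous (@coshR R).
Proof.
rewrite (_ : @coshR R = fun t => expR t * 2^-1 + expR (- t) * 2^-1).
  exact: continuous_expR_comb.
by apply/funext => t; rewrite /coshR mulrDl.
Qed.

Lemma continuous_sinhR : continuous (@sinhR R).
Proof.
rewrite (_ : @sinhR R = fun t => expR t * 2^-1 + expR (- t) * - 2^-1).
  exact: continuous_expR_comb.
by apply/funext => t; rewrite /sinhR mulrDl mulrN mulNr.
Qed.

Lemma continuous_pair (U W : topologicalType) (f : R -> U) (g : R -> W) :
  continuous f -> continuous g -> continuous (fun t => (f t, g t)).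
Proof.
move=> cf cg t.
by apply: (@cvg_pair _ _ _ (nbhs t) (nbhs (f t)) (nbhs (g t))); [exact: cf|exact: cg].
Qed.

Lemma continuous_V m (v : R -> R) : geodesic m -> (forall t, plane (m t)) ->
  continuous v -> continuous (fun t => V (m t) (v t)).
Proof.
move=> gm Pm cv; have [c1 c2 ch] := geodesic_continuous gm.
have cc : continuous (fun t => coshR (v t)).
  by move=> r; apply: (continuous_comp (f := v)); [exact: cv|exact: continuous_coshR].
have cs : continuous (fun t => sinhR (v t)).
  by move=> r; apply: (continuous_comp (f := v)); [exact: cv|exact: continuous_sinhR].
have ck : continuous (fun t => (coshR (v t) - height (m t) * sinhR (v t))^-1).
  move=> r; apply: cvgV; first by rewrite gt_eqF // V_den_gt0.
  by apply: cvgB; [exact: cc|apply: cvgM; [exact: ch|exact: cs]].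
apply: continuous_pair => [|r]; last by apply: cvgM; [exact: ck|exact: ch].
apply: continuous_pair => r; apply: cvgM; try exact: c1; try exact: c2;
  by apply: cvgM; [exact: ck|exact: cc].
Qed.

(** Where k t < 1 the square root has its default value 0 and continuity persists, so paths built
    from [arcoshR] are continuous on the whole line and not only where k t >= 1. *)
Lemma continuous_arcoshR (k : R -> R) : (forall t, 0 < k t) -> continuous k ->
  continuous (fun t => arcoshR (k t)).
Proof.
move=> k0 ck t.
pose f := fun r : R => r + Num.sqrt (r ^+ 2 - 1).
rewrite (_ : (fun t => _) = @ln R \o (f \o k)) //.
apply: continuous_comp; last first.
  apply: continuous_ln; rewrite /f /=.
  by rewrite (lt_le_trans (k0 t)) // lerDl sqrtr_ge0.
apply: continuous_comp; first exact: ck.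
rewrite /f; apply: cvgD; first exact: cvg_id.
apply: (continuous_comp (f := fun r : R => r ^+ 2 - 1)); last exact: sqrt_continuous.
by apply: cvgB; [exact: exprn_continuous|exact: cvg_cst].
Qed.

Lemma coshR_gt0 t : 0 < coshR t.
Proof. exact: lt_le_trans ltr01 (coshR_ge1 t). Qed.

Lemma ler_sqr_coshR u s : (coshR u ^+ 2 <= coshR s ^+ 2) = (coshR u <= coshR s).
Proof. by rewrite ler_sqr // nnegrE; apply/ltW/coshR_gt0. Qed.

Lemma ler_coshR_norm u s : 0 <= s -> (coshR u <= coshR s) = (`|u| <= s).
Proof. by move=> s0; rewrite -(coshR_norm u) ler_coshR. Qed.

Lemma coshR_norm_inj u s : 0 <= s -> coshR u = coshR s -> `|u| = s.
Proof.
move=> s0 e; apply/eqP; rewrite eq_le -ler_coshR_norm // e lexx /=.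
by rewrite -ler_coshR // coshR_norm e lexx.
Qed.

(** * Paths inside a strip *)

Section MoveOut.
Variables (W : 'M[R[i]]_2) (c : R -> point3 R) (s : R).
Hypotheses (gc : geodesic c) (Pc : forall t, plane (c t))
  (Wc : axis W = range c) (s0 : 0 < s).

Let D := Eq W s `\` Eq_curves W s.

(** This is the hyperbolic Pythagorean theorem: the null vectors of [c] have no normal coordinate,
    so passing from x to [V x u] multiplies both pairings by cosh u. *)
Lemma set_dist_V x u : plane x -> [/\ 0 <= set_dist x (range c),
  0 <= set_dist (V x u) (range c) &
  coshR (set_dist (V x u) (range c)) =
  coshR u * coshR (set_dist x (range c))].
Proof.
move=> Px; have Hx := plane_H3 Px.
have [a [b [cE aa bb ab]]] := geodesic_hlift gc.
have [dx e1 _] := set_dist_geodesic gc Hx cE aa bb ab.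
have [dV e2 _] := set_dist_geodesic gc (V_H3 u Px) cE aa bb ab.
have [a3 b3] : a 0 i3 = 0 /\ b 0 i3 = 0.
  apply: (@expR_comb_periodic _ _ _ 1 ltr01) => t.
  have e r : expR r * a 0 i3 + expR (- r) * b 0 i3 = 0.
    by have /planeE[_ <-] := Pc r; rewrite /ncoord cE !mxE.
  by rewrite !e.
have c0 (r : R) : 0 <= coshR r by exact: ltW (coshR_gt0 r).
split=> //; apply/eqP; rewrite -(@eqrXn2 _ 2) //; last exact: mulr_ge0.
rewrite e2 exprMn e1 hlift_V // !mformE !(mformC (normal R)) !mform_normal a3 b3.
by apply/eqP; ring.
Qed.

(** A point V x u at distance s from the axis lies on one of the two boundary curves exactly when
    cosh u = cosh s, that is, when x is on the axis; [D] consists of the others. *)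
Lemma mem_D x u : plane x ->
  coshR u * coshR (set_dist x (range c)) = coshR s ->
  1 < coshR (set_dist x (range c)) -> D (V x u).
Proof.
move=> Px e d1; have [dx dV eV] := set_dist_V u Px.
have EV : Eq W s (V x u).
  split; first exact: V_H3.
  rewrite Wc; rewrite -(ger0_norm dV); apply: coshR_norm_inj; first exact: ltW.
  by rewrite eV.
split=> // -[_ H].
have us : coshR u = coshR s.
  have nV := ncoord_V u Px.
  by case: H nV => -[x' Px' <-]; rewrite ncoord_V // => /sinhR_inj <-;
    rewrite ?coshRN.
move: e; rewrite us => /eqP; rewrite -[RHS in _ == RHS]mulr1.
by rewrite (inj_eq (mulfI _)) (gt_eqF d1, gt_eqF (coshR_gt0 s)).
Qed.

Lemma D_mem x u : plane x -> D (V x u) ->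
  coshR u * coshR (set_dist x (range c)) = coshR s /\
  1 < coshR (set_dist x (range c)).
Proof.
move=> Px [EV nV]; have [dx dV eV] := set_dist_V u Px.
have e : coshR u * coshR (set_dist x (range c)) = coshR s.
  by rewrite -eV -Wc; case: EV => _ ->.
split=> //; rewrite lt_neqAle coshR_ge1 andbT; apply/eqP => d1.
apply: nV; split=> //; move: e; rewrite -d1 mulr1.
move=> /(coshR_norm_inj (ltW s0)); rewrite -[u in V x u](opprK u).
have [u0 us|u0 us] := ger0P u.
  by left; exists x => //; rewrite opprK us.
by right; exists x => //; rewrite -us.
Qed.

(* The point x is moved along m until its distance from the axis is s, and its
   normal coordinate is decreased so as to keep V at distance s. *)
Lemma strip_path m u : geodesic m -> (forall t, plane (m t)) ->
  D (V (m 0) u) ->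
  (forall t t', 0 <= t -> t <= t' -> coshR (set_dist (m t) (range c)) <=
      coshR (set_dist (m t') (range c))) ->
  continuous (fun t => coshR (set_dist (m t) (range c))) ->
  (exists2 t, 0 <= t & coshR s <= coshR (set_dist (m t) (range c))) ->
  exists t1, connected_component D (V (m 0) u) (m t1).
Proof.
move=> gm Pm DV mono cF [T T0 FT]; have [e d1] := D_mem (Pm 0) DV.
set f := fun t => coshR (set_dist (m t) (range c)) in mono cF FT *.
have f1 t : 0 < f t by exact: coshR_gt0.
have fE t : coshR (set_dist (m t) (range c)) = f t by [].
rewrite fE in e d1.
have {}mono t t' : 0 <= t -> t <= t' -> f t <= f t' by exact: mono.
have {}FT : coshR s <= f T by exact: FT.
clearbody f.
have Fs : f 0 <= coshR s.
  by rewrite -e; apply: ler_peMl; [exact: ltW|exact: coshR_ge1].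
have [t1] : exists2 t1, t1 \in `[0, T] & f t1 = coshR s.
  apply: IVT => //; first exact: continuous_subspaceT.
  by rewrite (min_idPl (mono _ _ (lexx _) T0)) (max_idPr (mono _ _ (lexx _) T0)) Fs.
rewrite in_itv /= => /andP[t10 _] ft1.
(* By [set_dist_V], [k t] is the value of cosh (v t) that keeps the distance equal to s. The sign
   [sg] restores that of [u], which [arcoshR] loses. *)
pose k t := coshR s / f t.
pose sg : R := if 0 <= u then 1 else -1.
pose v t := sg * arcoshR (k t).
have cs0 := coshR_gt0 s.
have k0 t : 0 < k t by rewrite divr_gt0.
have v0 : v 0 = u.
  rewrite /v /k -e mulfK ?gt_eqF // arcosh_cosh /sg.
  case: ifP => u0; first by rewrite mul1r ger0_norm.
  by rewrite ltr0_norm ?mulN1r ?opprK // ltNge u0.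
have v1 : v t1 = 0.
  rewrite /v /k ft1 divff ?gt_eqF // -(_ : coshR 0 = 1) ?arcosh_cosh ?normr0 ?mulr0 //.
  by rewrite /coshR oppr0 expR0; field.
have cv : continuous v.
  move=> t; apply: cvgMr; apply: continuous_arcoshR => // r.
  by apply: cvgMr; apply: cvgV; [rewrite gt_eqF|exact: cF].
exists t1; pose P t := V (m t) (v t).
have P0 : P 0 = V (m 0) u by rewrite /P v0.
have P1 : P t1 = m t1 by rewrite /P v1 V0.
have B0 : (P @` `[0, t1]) (V (m 0) u).
  by exists 0 => //; rewrite /= in_itv /= lexx t10.
have B1 : (P @` `[0, t1]) (m t1).
  by exists t1 => //; rewrite /= in_itv /= lexx t10.
apply: (connected_component_max B0 _ _ B1).
  move=> _ [t /= + <-]; rewrite in_itv /= => /andP[t0 tt1]; apply: mem_D; rewrite ?fE //.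
    have -> : coshR (v t) = k t.
      have -> : coshR (v t) = coshR (arcoshR (k t)).
        by rewrite /v /sg; case: ifP => _; rewrite ?mul1r // mulN1r coshRN.
      by rewrite arcoshRK // /k ler_pdivlMr // mul1r -ft1 mono.
    by rewrite /k divfK // gt_eqF //; exact: f1.
  exact: lt_le_trans d1 (mono _ _ (lexx _) t0).
apply: connected_continuous_connected; first exact: segment_connected.
by apply: continuous_subspaceT; exact: continuous_V.
Qed.

(** Up to the factor 4, p and r are products of the pairings of one end of [m] with the two ends of
    [c]. If both vanish, each end of [m] is an end of [c], the lines coincide, and the squared cosh
    is constantly 1. *)
Lemma set_dist_along m : geodesic m -> exists p q r : R,
  [/\ 0 <= p, 0 <= r,
      forall t, coshR (set_dist (m t) (range c)) ^+ 2 =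
        p * expR t ^+ 2 + q + r * expR t ^- 2 &
      p = 0 -> r = 0 -> q = 1].
Proof.
move=> gm; have [Hm _] := gm; have [Hc _] := gc.
have [a [b [cE aa bb ab]]] := geodesic_hlift gc.
have [a' [b' [mE aa' bb' ab']]] := geodesic_hlift gm.
have pos (w : 'rV[R]_4) : (forall t, 0 <= mform (hlift (m t)) w) ->
    0 <= mform a' w /\ 0 <= mform b' w.
  by move=> H; apply: expR_comb_ge0 => t; rewrite -!mformZl -mformDl -mE.
have posc t : 0 <= mform (hlift (m t)) a /\ 0 <= mform (hlift (m t)) b.
  apply: expR_comb_ge0 => r; rewrite -!mformZr -mformDr -cE.
  exact: le_trans ler01 (mform_hlift_ge1 (Hm t) (Hc r)).
have [a'a b'a] := pos a (fun t => (posc t).1).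
have [a'b b'b] := pos b (fun t => (posc t).2).
exists (4 * (mform a' a * mform a' b)),
  (4 * (mform a' a * mform b' b + mform b' a * mform a' b)),
  (4 * (mform b' a * mform b' b)); split.
- by rewrite !mulr_ge0.
- by rewrite !mulr_ge0.
- move=> t; have [_ -> _] := set_dist_geodesic gc (Hm t) cE aa bb ab.
  by rewrite mE !mformE expRN; field; rewrite gt_eqF ?expR_gt0.
have half : (2^-1 : R) != 0 by rewrite invr_eq0 pnatr_eq0.
have nz w w' : mform w w' = 2^-1 :> R -> w != 0 /\ w' != 0.
  move=> h; split; apply/eqP => w0; move/eqP: h; rewrite w0.
    by rewrite -(scale0r 0) mformZl mul0r eq_sym (negPf half).
  by rewrite -(scale0r 0) mformZr mul0r eq_sym (negPf half).
have [a0 b0] := nz _ _ ab.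
have dual (d f : 'rV[R]_4) : mform d d = 0 -> mform f f = 0 -> mform d f = 2^-1 ->
    mform a' d = 0 -> mform b' d * mform b' f = 0 ->
    4 * (mform a' d * mform b' f + mform b' d * mform a' f) = 1.
  move=> dd ff df a'd b'df; have [d0 f0] := nz _ _ df.
  have [k a'E] : exists k, a' = k *: d.
    by apply: mform_null; rewrite ?dd // mformC.
  have kd : k * mform b' d = 2^-1 by rewrite -ab' a'E mformZl mformC.
  have b'd0 : mform b' d != 0.
    by apply: contra_neq half => z; rewrite -kd z mulr0.
  have b'f : mform b' f = 0.
    by apply/eqP; move/eqP: b'df; rewrite mulf_eq0 (negPf b'd0).
  by rewrite a'E !mformZl dd df b'f mulrCA mulrA kd; field.
move=> /eqP; rewrite mulf_eq0 pnatr_eq0 /= mulf_eq0 => /orP[] /eqP z;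
  move=> /eqP; rewrite mulf_eq0 pnatr_eq0 /= => /eqP z'.
  exact: dual aa bb ab z z'.
by rewrite -[RHS](dual b a bb aa (etrans (mformC b a) ab) z
  (etrans (mulrC _ _) z')); ring.
Qed.

(** Reversing [m] exchanges p and r, so r <= p may be assumed. Then p > 0, as otherwise [m] would be
    the axis although its point at t0 is off it. With E = e^(2t), p E + q + r / E is nondecreasing
    for E >= 1 and unbounded. *)
Lemma strip_component m t0 u : geodesic m -> (forall t, plane (m t)) ->
  D (V (m t0) u) -> exists t1, connected_component D (V (m t0) u) (m t1).
Proof.
move=> gm Pm.
have [p [q [r [p0 r0 fE pr]]]] := set_dist_along (geodesic_shift t0 gm).
have c1 t : 1 <= coshR (set_dist (m (t + t0)) (range c)) by exact: coshR_ge1.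
have sqE t : coshR (set_dist (m (t + t0)) (range c)) =
    Num.sqrt (p * expR t ^+ 2 + q + r * expR t ^- 2).
  by rewrite -fE sqrtr_sqr ger0_norm //; exact: ltW (coshR_gt0 _).
wlog rp : m t0 gm Pm p q r p0 r0 fE pr c1 sqE / r <= p => [H|] DV.
  have [rp|pr'] := leP r p; first exact: (H m t0 gm Pm p q r).
  have [||||||||||t1] := H (fun t => m (- t)) (- t0) _ _ r q p.
  - exact: geodesic_rev.
  - by [].
  - by [].
  - by [].
  - move=> t; rewrite opprD opprK fE expRN exprVn invrK.
    by rewrite addrC (addrC (p * _)) addrA.
  - by move=> z1 z2; exact: pr.
  - by move=> t; rewrite opprD opprK.
  - move=> t; rewrite opprD opprK sqE expRN exprVn invrK.
    by rewrite addrC (addrC (p * _)) addrA.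
  - exact: ltW.
  - by rewrite opprK.
  by rewrite opprK => ct; exists (- t1).
have [e d1] := D_mem (Pm t0) DV.
have {}d1 : 1 < p + q + r.
  have := fE 0; rewrite add0r expR0 !expr1n invr1 !mulr1 => <-.
  by rewrite exprn_egt1 .
have {}p0 : 0 < p.
  rewrite lt_neqAle p0 andbT eq_sym; apply/eqP => pz; move: d1.
  have rz : r = 0 by apply/eqP; rewrite eq_le r0 andbT -pz.
  by rewrite pr // pz rz add0r addr0 ltxx.
have mono t t' : 0 <= t -> t <= t' ->
    p * expR t ^+ 2 + q + r * expR t ^- 2 <= p * expR t' ^+ 2 + q + r * expR t' ^- 2.
  move=> t0' tt'.
  have E1 : 1 <= expR t ^+ 2 by rewrite exprn_ege1 // -expR0 ler_expR.
  have E2 : expR t ^+ 2 <= expR t' ^+ 2 by rewrite ler_sqr ?nnegrE ?expR_ge0 // ler_expR.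
  move: (expR t ^+ 2) (expR t' ^+ 2) E1 E2 => E E' E1 E2.
  have [E0 E'0] : 0 < E /\ 0 < E' by split; lra.
  rewrite -subr_ge0.
  have -> : p * E' + q + r / E' - (p * E + q + r / E) =
     (E' - E) * (p - r / (E * E')) by field; rewrite !gt_eqF.
  rewrite mulr_ge0 ?subr_ge0 // ler_pdivrMr ?mulr_gt0 //.
  by apply: (le_trans rp); rewrite ler_peMr ?(ltW p0) //; nra.
have H := @strip_path (fun t => m (t + t0)) u (geodesic_shift t0 gm)
  (fun t => Pm (t + t0)).
rewrite /= add0r in H; have [||||t1 ct] := H.
- exact: DV.
- by move=> t t' t0' tt'; rewrite !sqE ler_wsqrtr // mono.
- have cE : continuous (fun t : R => expR t ^+ 2).
    move=> z; apply: (continuous_comp (f := expR) (g := fun r : R => r ^+ 2)).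
      exact: continuous_expR.
    exact: exprn_continuous.
  have cS : continuous (fun t => p * expR t ^+ 2 + q + r * expR t ^- 2).
    move=> t; apply: cvgD; last first.
      by apply: cvgMr; apply: cvgV; [rewrite expf_neq0 // gt_eqF ?expR_gt0|exact: cE].
    by apply: cvgD; [apply: cvgMr; exact: cE|exact: cvg_cst].
  rewrite (funext sqE) => t.
  exact: (continuous_comp (cS t) (@sqrt_continuous R _)).
(* As e^(2T) >= T, the term p e^(2T) is at least p T = S, which absorbs q and leaves cosh^2 s. *)
- pose S := coshR s ^+ 2 + `|q|; pose T := S / p.
  have S0 : 0 <= S by rewrite addr_ge0 ?sqr_ge0.
  exists T; first by rewrite divr_ge0 // ltW.
  rewrite -ler_sqr_coshR fE.
  have ET : T <= expR T ^+ 2.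
    have := expR_ge1Dx T; have T0 : 0 <= T by rewrite divr_ge0 // ltW.
    by move: (expR T) => E; nra.
  have : S <= p * expR T ^+ 2 by rewrite mulrC -ler_pdivrMr.
  have rE : 0 <= r * expR T ^- 2 by rewrite mulr_ge0 ?invr_ge0 ?sqr_ge0.
  rewrite /S; have := ler_norm (- q); rewrite normrN.
  by move: (r * _) rE (p * _) => ? ? ?; lra.
by exists (t1 + t0).
Qed.

End MoveOut.
End Strip.

(** * Fixed points of the involution on the surface *)

Theorem proposition11p2 (R : realType) (G : set 'M[R[i]]_2)
  (A B hp hA hB : 'M[R[i]]_2) (p pA pB : point3 R) (s : R)
  (G_subgroup : psl_subgroup G)
  (G_discrete : discrete_subgroup G)
  (G_disc : invariant_disc G)
  (G_free : free_of_rank_two G)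
  (G_parabolic : no_parabolic G)
  (pA_plane : plane pA)
  (pB_plane : plane pB)
  (hp_half_turn : half_turn (range (V p)) hp)
  (hA_half_turn : half_turn (range (V pA)) hA)
  (hB_half_turn : half_turn (range (V pB)) hB)
  (A_factors : eq_pm A (hp * hA))
  (B_factors : eq_pm B (hp * hB))
  (AB_stopping : stopping G A B p pA pB)
  (s_gt0 : 0 < s) :
  let Ss := surface G (pair_commutator B A) s in
  let E := [set V p s; V p (- s); V pA s; V pA (- s); V pB s; V pB (- s)] in
  (forall y, E y -> Ss (to_quotient G y)) /\
  [set O | Ss O /\ descend hp O = O] = to_quotient G @` E.
Proof.
move=> Ss E.
have [gAB axp _ _] := AB_stopping; have [GA GB _] := gAB.
have fAB : freely A B.
  have [X [Y [gXY fXY]]] := G_free.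
  exact: (generators_freely G_subgroup gXY fXY gAB).
have [dp p2 pfix] := hp_half_turn; have [dA A2 Afix] := hA_half_turn.
have [dB B2 Bfix] := hB_half_turn.
have up := det1_unit dp; have uA := det1_unit dA; have uB := det1_unit dB.
have [axAp axBp] : (axis A `&` axis B) p by rewrite axp.
have fixV k (q : point3 R) (u : R) : [set x | H3 x /\ act k x = x] = range (V q) ->
    act k (V q u) = V q u.
  move=> e; have : [set x | H3 x /\ act k x = x] (V q u) by rewrite e; exists u.
  by case.
(* That p lies in the plane follows from its position on the axis of A. *)
have p_plane : plane p.
  by apply: (core_plane G_subgroup G_disc); exact: axis_core axAp.
have hpp : act hp p = p by have := fixV hp p 0 pfix; rewrite V0.
have axApA : axis A pA.
  exact: (half_turn_axis G_subgroup G_disc GA A_factors dp hpp pA_plane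
    hA_half_turn axAp).
have axBpB : axis B pB.
  exact: (half_turn_axis G_subgroup G_disc GB B_factors dp hpp pB_plane
    hB_half_turn axBp).
have mk q k : q = p /\ k = hp \/ q = pA /\ k = hA \/ q = pB /\ k = hB ->
    [/\ plane q, exists2 T, G T & axis T q,
        [set x | H3 x /\ act k x = x] = range (V q) &
        forall t, t = s \/ t = - s -> E (V q t)].
  case=> [[-> ->]|[[-> ->]|[-> ->]]]; split=> //; try (by exists A); try (by exists B);
    move=> t [] ->; rewrite /E /=; tauto.
have coreq q : (exists2 T, G T & axis T q) -> convex_core G q.
  by move=> [T GT]; exact: axis_core.
have EV y : E y -> exists q t k, [/\ y = V q t, t = s \/ t = - s &
    q = p /\ k = hp \/ q = pA /\ k = hA \/ q = pB /\ k = hB].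
  rewrite /E /= => h.
  by move: h => [[[[[]|]|]|]|] ->;
    [exists p, s, hp|exists p, (- s), hp|exists pA, s, hA|exists pA, (- s), hA
    |exists pB, s, hB|exists pB, (- s), hB]; split=> //; tauto.
have ESs y : E y -> Ss (to_quotient G y).
  move=> /EV[q [t [k [-> tE /mk[Pq Tq _ _]]]]].
  left; case: tE => ->; [left|right];
    (eexists; last by []); exists q => //; exact: coreq.
split=> //.
have desc y : H3 y -> descend hp (to_quotient G y) = to_quotient G (act hp y).
  move=> Hy; apply/seteqP; split=> [_ [_ [g Gg <-] <-]|_ [g Gg <-]];
    have dg := psl_det G_subgroup Gg.
    have [k Gk e] := half_turn_normalizes G_subgroup gAB up uA uB p2 A2 B2
      A_factors B_factors Gg.
    exists k => //; have dk := psl_det G_subgroup Gk.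
    by rewrite -!actM // (act_pm y e).
  have [k Gk e] := half_turn_normalizesV G_subgroup gAB up uA uB p2 A2 B2
    A_factors B_factors Gg.
  exists (act k y); first by exists k.
  by rewrite -!actM // ?(psl_det G_subgroup Gk) // (act_pm y e).
have key y : H3 y -> descend hp (to_quotient G y) = to_quotient G y ->
    exists w q u k, [/\ G w, q = p /\ k = hp \/ q = pA /\ k = hA \/ q = pB /\ k = hB
      & y = act w (V q u)].
  move=> Hy; rewrite desc // => orb.
  have : to_quotient G (act hp y) (act hp y).
    by exists 1; [exact: psl1|rewrite act1 //; exact: act_H3].
  rewrite orb => -[g Gg gy].
  have dg := psl_det G_subgroup Gg; have dV := det1V dg.
  have GV := pslV G_subgroup Gg.
  have hy : act (g^-1 * hp) y = y by rewrite actM // -gy actK.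
  have dh : \det (g^-1 * hp) = 1 by rewrite det_mulmx dV dp mulr1.
  have h2 : eq_pm (g^-1 * hp * (g^-1 * hp)) 1.
    have [k Gk e] := half_turn_normalizes G_subgroup gAB up uA uB p2 A2 B2
      A_factors B_factors GV.
    have e2 : eq_pm (g^-1 * hp * (g^-1 * hp)) (g^-1 * k).
      rewrite mulrA -[X in eq_pm (X * _)]mulrA.
      have := eq_pmM (eq_pmM (eq_pm_refl g^-1) e) (eq_pm_refl hp).
      move=> /eq_pm_trans; apply; rewrite -!mulrA (mulrA _ k).
      by rewrite -[X in eq_pm _ X]mulr1; apply: eq_pmM p2; left.
    apply: (fixing_trivial G_subgroup G_discrete gAB fAB _ Hy).
      by apply: (psl_pm G_subgroup e2); exact: pslM.
    by rewrite actM // hy.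
  have [w Gw [k [kE e]]] := involution_conjugate G_subgroup gAB fAB up uA uB
    p2 A2 B2 A_factors B_factors GV h2.
  have dw := psl_det G_subgroup Gw.
  have [q' kq] : exists q', q' = p /\ k = hp \/ q' = pA /\ k = hA \/ q' = pB /\ k = hB.
    by case: kE => [->|[->|->]]; [exists p|exists pA|exists pB]; tauto.
  have [_ _ fixk _] := mk _ _ kq.
  have Hwy : H3 (act w^-1 y) by apply: act_H3 => //; exact: det1V.
  have dk : \det k = 1 by case: kE => [->|[->|->]].
  have kw : act k (act w^-1 y) = act w^-1 y.
    have e1 : eq_pm (w^-1 * (g^-1 * hp)) (k * w^-1).
      have := eq_pmM (eq_pmM (eq_pm_refl w^-1) e) (eq_pm_refl w^-1).
      have uw := det1_unit dw.
      by rewrite !mulrA mulrK // mulVr // mul1r.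
    by rewrite -actM ?det1V // -(act_pm y e1) actM ?det1V // hy.
  have : [set x | H3 x /\ act k x = x] (act w^-1 y) by split.
  rewrite fixk => -[u _ yE]; exists w, q', u, k; split=> //.
  by rewrite yE actVK.
apply/seteqP; split; last first.
  move=> _ [y Ey <-]; split; first exact: ESs.
  have [q [t [k [yE tE qk]]]] := EV y Ey.
  have [Pq _ fixk _] := mk _ _ qk.
  have Hy : H3 y by rewrite yE; exact: V_H3.
  have ky : act k y = y by rewrite yE; exact: fixV.
  (* Since k fixes y, hp y = hp k y, which for k = hA or hB is A y or B y, a point of the same
     orbit. *)
  rewrite desc //; case: qk => [[_ kE]|[[_ kE]|[_ kE]]].
  - by rewrite -kE ky.
  - rewrite -{1}ky kE -actM // -(act_pm y A_factors).
    exact: to_quotient_act.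
  - rewrite -{1}ky kE -actM // -(act_pm y B_factors).
    exact: to_quotient_act.
have fin y t : H3 y -> descend hp (to_quotient G y) = to_quotient G y ->
    t = s \/ t = - s -> ncoord y = sinhR t -> (to_quotient G @` E) (to_quotient G y).
  move=> Hy /(key _ Hy)[w [q [u [k [Gw qk yE]]]]] tE yt.
  have [Pq _ _ EVq] := mk _ _ qk.
  have HV := V_H3 u Pq.
  have ut : u = t.
    by apply: sinhR_inj; rewrite -yt yE (ncoord_actG G_subgroup G_disc) // ncoord_V.
  exists (V q t); first exact: EVq.
  by rewrite yE ut to_quotient_act // -ut.
have cp := core_plane G_subgroup G_disc.
move=> _ [[[[_ [x cx <-] <-]|[_ [x cx <-] <-]]|[y yRec <-]] fixO].
- have Px := cp _ cx.
  by apply: (fin _ s) => //; [exact: V_H3|left|exact: ncoord_V].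
- have Px := cp _ cx.
  by apply: (fin _ (- s)) => //; [exact: V_H3|right|exact: ncoord_V].
case: yRec => [[[Hy _] [[x Px xy]|[x Px xy]]]|[Dy disj]].
- by apply: (fin _ s) => //; [left|rewrite -xy; exact: ncoord_V].
- by apply: (fin _ (- s)) => //; [right|rewrite -xy; exact: ncoord_V].
exfalso.
have [[Hy yW] _] := Dy.
have GW : G (pair_commutator B A).
  by do !apply: pslM => //; exact: pslV.
(* Were the axis empty, the distance would be the infimum of the empty set, which is 0 by
   convention, against s > 0. *)
have [W0|/eqP/set0P[x0 [c [gc [[l l0 Wc] _]]]]] :=
    pselect (axis (pair_commutator B A) = set0).
  by move: yW s_gt0; rewrite W0 /set_dist image_set0 inf0 => <-; rewrite ltxx.
have Wr := axis_geodesic G_subgroup GW gc l0 Wc.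
have Pc := axis_plane G_subgroup G_disc GW gc l0 Wc.
have [w [q [u [k [Gw qk yE]]]]] := key _ Hy fixO.
have [Pq [T GT axTq] _ _] := mk _ _ qk.
have yV : y = V (act w q) u by rewrite yE (act_V G_subgroup G_disc).
have GT' : G (w * T * w^-1).
  by do !apply: pslM => //; exact: pslV.
have axm := axis_act G_subgroup Gw GT axTq.
have [m [gm [[l' l'0 Tm] [t0 _ mt0]]]] := axm.
have Pm := axis_plane G_subgroup G_disc GT' gm l'0 Tm.
have [|t1 ct1] := strip_component (t0 := t0) (u := u) gc Pc Wr s_gt0 gm Pm.
  by rewrite mt0 -yV.
suff : set0 (m t1) by [].
rewrite -disj; split; first by rewrite mt0 -yV in ct1.
apply: (axis_core G_subgroup G_disc GT'); exists m; split=> //.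
by split; [exists l'|exists t1].
Qed.
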